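(* Let $K$ be a field with $\operatorname{char}(K)=0$, let $A_1(K)=K\langle x,y \mid yx-xy=1\rangle$, and let $\alpha$ be the exchange involution of $A_1(K)$. Then every $\alpha$-endomorphism $f$ of $A_1(K)$ is an $\alpha$-automorphism, i.e. $f$ is bijective.
   Context: $A_1(K)=K\langle x,y \mid yx-xy=1\rangle$ is the first Weyl algebra: the unital associative $K$-algebra generated by $x,y$ subject to $yx-xy=1$. The exchange involution $\alpha:A_1(K)\to A_1(K)$ is the $K$-linear antihomomorphism ($\alpha(ab)=\alpha(b)\alpha(a)$) with $\alpha(x)=y$, $\alpha(y)=x$. An $\alpha$-endomorphism of $A_1(K)$ is a ($K$-algebra) endomorphism $f$ of $A_1(K)$ such that $f(\alpha(w))=\alpha(f(w))$ for every $w\in A_1(K)$. An $\alpha$-automorphism is an $\alpha$-endomorphism that is an automorphism. *)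

(* Defs.v *)
From HB Require Import structures.
From mathcomp Require Import all_boot all_order all_algebra.
From mathcomp Require Import finmap boolp ring_quotient monalg.

Set Implicit Arguments.
Unset Strict Implicit.
Unset Printing Implicit Defensive.

Import GRing.Theory.
Local Open Scope ring_scope.
Local Open Scope quotient_scope.

(* K<x, y>: the monoid algebra of the free monoid on two letters, where
   false is the letter x and true is the letter y. *)
Notation free2 K := {malg K[{fmonom bool}]}.

Section FreeAlgebra.
Variable K : fieldType.
Implicit Types (p q r : free2 K) (c : K) (w : {fmonom bool}).

Definition free_x : free2 K := << fmu false >>.
Definition free_y : free2 K := << fmu true >>.

Definition weyl_relator : free2 K := free_y * free_x - free_x * free_y - 1.

(* The two-sided ideal generated by yx - xy - 1. *)
Definition weyl_ideal : {pred free2 K} :=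
  fun p => `[< exists s : seq (free2 K * free2 K),
                 p = \sum_(ab <- s) ab.1 * weyl_relator * ab.2 >].

Lemma weyl_idealP p :
  reflect (exists s : seq (free2 K * free2 K),
             p = \sum_(ab <- s) ab.1 * weyl_relator * ab.2)
          (p \in weyl_ideal).
Proof. exact: asboolP. Qed.

Lemma weyl_ideal_zmod : zmod_closed weyl_ideal.
Proof.
split; first by apply/weyl_idealP; exists [::]; rewrite big_nil.
move=> _ _ /weyl_idealP[s ->] /weyl_idealP[t ->]; apply/weyl_idealP.
exists (s ++ [seq (- ab.1, ab.2) | ab <- t]).
rewrite big_cat big_map -sumrN; congr (_ + _).
by apply: eq_bigr => ab _; rewrite !mulNr.
Qed.

HB.instance Definition _ :=
  GRing.isZmodClosed.Build (free2 K) weyl_ideal weyl_ideal_zmod.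

Lemma weyl_idealMl p q : q \in weyl_ideal -> p * q \in weyl_ideal.
Proof.
move=> /weyl_idealP[s ->]; apply/weyl_idealP.
exists [seq (p * ab.1, ab.2) | ab <- s].
by rewrite big_map mulr_sumr; apply: eq_bigr => ab _; rewrite !mulrA.
Qed.

Lemma weyl_idealMr p q : p \in weyl_ideal -> p * q \in weyl_ideal.
Proof.
move=> /weyl_idealP[s ->]; apply/weyl_idealP.
exists [seq (ab.1, ab.2 * q) | ab <- s].
rewrite big_map mulr_suml; apply: eq_bigr => ab _; exact/esym/mulrA.
Qed.

Lemma weyl_idealZ c p : p \in weyl_ideal -> c *: p \in weyl_ideal.
Proof. by rewrite -mul_malgC; apply: weyl_idealMl. Qed.

Lemma weyl_relator_in : weyl_relator \in weyl_ideal.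
Proof.
by apply/weyl_idealP; exists [:: (1, 1)]; rewrite big_seq1 mul1r mulr1.
Qed.

Lemma free_mulUU (c d : K) (v w : {fmonom bool}) :
  << c *g v >> * << d *g w >> = << c * d *g mmul v w >> :> free2 K.
Proof. exact: fgmulUU. Qed.

Lemma free_mulCC c p : c%:MP * p = p * c%:MP.
Proof.
rewrite [p]monalgE mulr_sumr mulr_suml; apply: eq_bigr => w _.
by rewrite !free_mulUU mulrC mul1m mulm1.
Qed.

Lemma free_scalerAr c p q : c *: (p * q) = p * (c *: q).
Proof.
rewrite -(mul_malgC c (p * q)) -(mul_malgC c q) (mulrA p).
by rewrite -(free_mulCC c p) (mulrA _ p).
Qed.

(* K<x, y> acts on K[t] by x = multiplication by t and y = d/dt; this shows
   that the ideal is proper. *)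
Definition letter_act (b : bool) (u : {poly K}) : {poly K} :=
  if b then u^`() else 'X * u.

Definition word_act (u : {poly K}) (w : {fmonom bool}) : {poly K} :=
  foldr letter_act u w.

Definition free_act (u : {poly K}) (p : free2 K) : {poly K} :=
  mmap (@polyC K) (word_act u) p.

Lemma word_act_sum (I : Type) (s : seq I) (c : I -> K) (u : I -> {poly K}) w :
  word_act (\sum_(i <- s) (c i)%:P * u i) w
  = \sum_(i <- s) (c i)%:P * word_act (u i) w.
Proof.
rewrite /word_act; elim: (w : seq bool) => //= b v ->; case: b => /=.
  by rewrite raddf_sum; apply: eq_bigr => i _; rewrite /= mul_polyC derivZ mul_polyC.
by rewrite mulr_sumr; apply: eq_bigr => i _; rewrite mulrCA.
Qed.

Lemma free_actM u p q : free_act u (p * q) = free_act (free_act u q) p.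
Proof.
rewrite /free_act {1}[p]monalgE mulr_suml raddf_sum [RHS]mmapE.
apply: eq_bigr => v _; rewrite [in RHS]mmapE word_act_sum mulr_sumr.
rewrite {1}[q]monalgE mulr_sumr raddf_sum; apply: eq_bigr => w _ /=.
rewrite free_mulUU mmapU /= polyCM -mulrA; congr (_ * (_ * _)).
by rewrite /word_act fmM foldr_cat.
Qed.

Lemma free_act1 u : free_act u 1 = u.
Proof. by rewrite -mpolyC1E /free_act mmapU /word_act fm1 mul1r. Qed.

Lemma free_act0 p : free_act 0 p = 0.
Proof.
rewrite /free_act mmapE big1 // => w _.
have := word_act_sum (Nil unit) (fun=> 0) (fun=> 0) w.
by rewrite !big_nil => ->; rewrite mulr0.
Qed.

Lemma free_act_x u : free_act u free_x = 'X * u.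
Proof. by rewrite /free_act /free_x mmapU /word_act fmU mul1r. Qed.

Lemma free_act_y u : free_act u free_y = u^`().
Proof. by rewrite /free_act /free_y mmapU /word_act fmU mul1r. Qed.

Lemma free_act_relator u : free_act u weyl_relator = 0.
Proof.
have actB (p q : free2 K) : free_act u (p - q) = free_act u p - free_act u q.
  exact: raddfB.
rewrite /weyl_relator; move: free_act_x free_act_y.
move: free_x free_y => x y act_x act_y.
have [yx xy] := (free_actM u y x, free_actM u x y).
apply: etrans (actB _ _) _; rewrite free_act1.
apply: etrans (congr1 (fun a => a - u) (actB _ _)) _.
apply: etrans (congr2 (fun a b => a - b - u) yx xy) _.
by rewrite act_y !act_x act_y derivM derivX mul1r addrK subrr.
Qed.

Lemma weyl_ideal_proper : 1 \notin weyl_ideal.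
Proof.
apply/weyl_idealP => -[s /(congr1 (free_act 1))].
rewrite free_act1.
rewrite /free_act raddf_sum big1 => [/eqP|ab _]; first by rewrite oner_eq0.
rewrite -[LHS]/(free_act 1 (ab.1 * weyl_relator * ab.2)).
by rewrite !free_actM free_act_relator free_act0.
Qed.

(* The K-linear antihomomorphism of K<x, y> exchanging x and y. *)
Definition word_exchange w : {fmonom bool} := FMonom (rev (map negb w)).

Definition free_exchange (p : free2 K) : free2 K :=
  mmap (malgC : K -> free2 K) (fun w => << word_exchange w >> : free2 K) p.

Lemma free_exchangeB : {morph free_exchange : p q / p - q}.
Proof. exact: raddfB. Qed.

Lemma free_exchange_sum (I : Type) (s : seq I) (F : I -> free2 K) :
  free_exchange (\sum_(i <- s) F i) = \sum_(i <- s) free_exchange (F i).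
Proof. exact: raddf_sum. Qed.

Lemma free_exchangeU c w :
  free_exchange << c *g w >> = << c *g word_exchange w >>.
Proof. by rewrite /free_exchange mmapU free_mulUU mulr1 mul1m. Qed.

Lemma word_exchangeM v w :
  word_exchange (mmul v w) = mmul (word_exchange w) (word_exchange v).
Proof. by apply/val_inj; rewrite /= !fmM map_cat rev_cat. Qed.

Lemma free_exchangeM p q :
  free_exchange (p * q) = free_exchange q * free_exchange p.
Proof.
rewrite [p]monalgE [q]monalgE mulr_suml !free_exchange_sum mulr_sumr.
apply: eq_bigr => v _; rewrite mulr_sumr mulr_suml free_exchange_sum.
apply: eq_bigr => w _.
by rewrite free_mulUU !free_exchangeU free_mulUU mulrC word_exchangeM.
Qed.

Lemma free_exchange1 : free_exchange 1 = 1.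
Proof.
rewrite -mpolyC1E free_exchangeU; congr (<< _ >>).
by apply/val_inj; rewrite /= fm1.
Qed.

Lemma free_exchangeZ c p : free_exchange (c *: p) = c *: free_exchange p.
Proof.
have exchC : free_exchange c%:MP = c%:MP.
  by rewrite free_exchangeU; congr (<< _ *g _ >>); apply/val_inj; rewrite /= fm1.
rewrite -!mul_malgC free_exchangeM exchC !mul_malgC.
by rewrite -[c%:MP]mulr1 mul_malgC -free_scalerAr mulr1.
Qed.

Lemma free_exchange_x : free_exchange free_x = free_y.
Proof.
by rewrite free_exchangeU; congr (<< _ >>); apply/val_inj; rewrite /= !fmU.
Qed.

Lemma free_exchange_y : free_exchange free_y = free_x.
Proof.
by rewrite free_exchangeU; congr (<< _ >>); apply/val_inj; rewrite /= !fmU.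
Qed.

Lemma free_exchange_ideal p :
  p \in weyl_ideal -> free_exchange p \in weyl_ideal.
Proof.
move=> /weyl_idealP[s ->]; rewrite free_exchange_sum; apply: rpred_sum => ab _.
rewrite !free_exchangeM; apply/weyl_idealMl/weyl_idealMr.
have -> : free_exchange weyl_relator = weyl_relator.
  rewrite /weyl_relator; move: free_exchange_x free_exchange_y.
  move: free_x free_y => x y ex_x ex_y.
  have [yx xy] := (free_exchangeM y x, free_exchangeM x y).
  rewrite ex_x ex_y in yx xy.
  apply: etrans (free_exchangeB _ _) _; rewrite free_exchange1; congr (_ - 1).
  exact: etrans (free_exchangeB _ _) (congr2 (fun a b => a - b) yx xy).
exact: weyl_relator_in.
Qed.

End FreeAlgebra.

(* A_1(K) = K<x, y | yx - xy = 1>. *)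
Definition weyl (K : fieldType) : Type := Quotient.quot (@weyl_ideal K).

HB.instance Definition _ (K : fieldType) :=
  EqQuotient.copy (weyl K) (Quotient.quot (@weyl_ideal K)).
HB.instance Definition _ (K : fieldType) :=
  ZmodQuotient.copy (weyl K) (Quotient.quot (@weyl_ideal K)).

(* The operations are locked so that unification never unfolds them. *)
Fact weyl_key : unit. Proof. exact: tt. Qed.

Section WeylAlgebra.
Variable K : fieldType.
Local Notation A := (weyl K).
Implicit Types (u v w : A) (p q : free2 K) (c : K).

Definition weyl_pi : free2 K -> A := locked_with weyl_key (fun p => \pi p).

Lemma weyl_piE p : weyl_pi p = \pi p.
Proof. by rewrite /weyl_pi unlock. Qed.

Lemma weyl_pi_eq p q : weyl_pi p = weyl_pi q <-> p - q \in @weyl_ideal K.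
Proof. by rewrite !weyl_piE Quotient.idealrBE; split=> /eqP. Qed.

Lemma weyl_piK u : weyl_pi (repr u) = u.
Proof. by rewrite weyl_piE reprK. Qed.

Lemma weyl_repr_pi p : repr (weyl_pi p) - p \in @weyl_ideal K.
Proof. by apply/weyl_pi_eq; rewrite weyl_piK. Qed.

Lemma weyl_piB p q : weyl_pi (p - q) = weyl_pi p - weyl_pi q.
Proof. by rewrite !weyl_piE; exact: raddfB. Qed.

Lemma weyl_piD p q : weyl_pi (p + q) = weyl_pi p + weyl_pi q.
Proof. by rewrite !weyl_piE; exact: raddfD. Qed.

Definition weyl_one : A := weyl_pi 1.
Definition weyl_mul : A -> A -> A :=
  locked_with weyl_key (fun u v => weyl_pi (repr u * repr v)).
Definition weyl_scale : K -> A -> A :=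
  locked_with weyl_key (fun c u => weyl_pi (c *: repr u)).

Lemma weyl_mul_pi p q : weyl_mul (weyl_pi p) (weyl_pi q) = weyl_pi (p * q).
Proof.
rewrite /weyl_mul unlock; apply/weyl_pi_eq.
set p' := repr _; set q' := repr _.
have -> : p' * q' - p * q = (p' - p) * q' + p * (q' - q).
  by rewrite mulrBl mulrBr addrA subrK.
by apply: rpredD; [apply: weyl_idealMr | apply: weyl_idealMl];
  apply: weyl_repr_pi.
Qed.

Lemma weyl_scale_pi c p : weyl_scale c (weyl_pi p) = weyl_pi (c *: p).
Proof.
rewrite /weyl_scale unlock; apply/weyl_pi_eq; rewrite -scalerBr.
exact/weyl_idealZ/weyl_repr_pi.
Qed.

Lemma weyl_mulA : associative weyl_mul.
Proof.
move=> u v w; rewrite -(weyl_piK u) -(weyl_piK v) -(weyl_piK w).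
by rewrite !weyl_mul_pi mulrA.
Qed.

Lemma weyl_mul1 : left_id weyl_one weyl_mul.
Proof. by move=> u; rewrite -(weyl_piK u) weyl_mul_pi mul1r. Qed.

Lemma weyl_mulr1 : right_id weyl_one weyl_mul.
Proof. by move=> u; rewrite -(weyl_piK u) weyl_mul_pi mulr1. Qed.

Lemma weyl_mulDl : left_distributive weyl_mul +%R.
Proof.
move=> u v w; rewrite -(weyl_piK u) -(weyl_piK v) -(weyl_piK w).
by rewrite -weyl_piD !weyl_mul_pi -weyl_piD mulrDl.
Qed.

Lemma weyl_mulDr : right_distributive weyl_mul +%R.
Proof.
move=> u v w; rewrite -(weyl_piK u) -(weyl_piK v) -(weyl_piK w).
by rewrite -weyl_piD !weyl_mul_pi -weyl_piD mulrDr.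
Qed.

Lemma weyl_one_neq0 : weyl_one != 0.
Proof.
apply: contra (@weyl_ideal_proper K) => /eqP one0.
rewrite -[1]subr0; apply/weyl_pi_eq; rewrite -/weyl_one one0.
by rewrite weyl_piE raddf0.
Qed.

HB.instance Definition _ := GRing.Zmodule_isNzRing.Build A
  weyl_mulA weyl_mul1 weyl_mulr1 weyl_mulDl weyl_mulDr weyl_one_neq0.

Lemma weyl_piM p q : weyl_pi (p * q) = weyl_pi p * weyl_pi q.
Proof. by rewrite -[RHS]/(weyl_mul _ _) weyl_mul_pi. Qed.

Lemma weyl_scaleA c d u : weyl_scale c (weyl_scale d u) = weyl_scale (c * d) u.
Proof. by rewrite -(weyl_piK u) !weyl_scale_pi scalerA. Qed.

Lemma weyl_scale1 : left_id 1 weyl_scale.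
Proof. by move=> u; rewrite -(weyl_piK u) weyl_scale_pi scale1r. Qed.

Lemma weyl_scaleDr : right_distributive weyl_scale +%R.
Proof.
move=> c u v; rewrite -(weyl_piK u) -(weyl_piK v).
by rewrite -weyl_piD !weyl_scale_pi -weyl_piD scalerDr.
Qed.

Lemma weyl_scaleDl u : {morph weyl_scale^~ u : c d / c + d}.
Proof.
by move=> c d; rewrite -(weyl_piK u) !weyl_scale_pi -weyl_piD scalerDl.
Qed.

HB.instance Definition _ := GRing.Zmodule_isLmodule.Build K A
  weyl_scaleA weyl_scale1 weyl_scaleDr weyl_scaleDl.

Lemma weyl_piZ c p : weyl_pi (c *: p) = c *: weyl_pi p.
Proof. by rewrite -[RHS]/(weyl_scale _ _) weyl_scale_pi. Qed.

Lemma weyl_scalerAl c u v : c *: (u * v) = c *: u * v.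
Proof.
rewrite -(weyl_piK u) -(weyl_piK v).
by rewrite -weyl_piM -!weyl_piZ -weyl_piM scalerAl.
Qed.

HB.instance Definition _ := GRing.Lmodule_isLalgebra.Build K A weyl_scalerAl.

Lemma weyl_scalerAr c u v : c *: (u * v) = u * (c *: v).
Proof.
rewrite -(weyl_piK u) -(weyl_piK v).
by rewrite -weyl_piM -!weyl_piZ -weyl_piM free_scalerAr.
Qed.

HB.instance Definition _ := GRing.Lalgebra_isAlgebra.Build K A weyl_scalerAr.

Definition weyl_x : A := weyl_pi (free_x K).
Definition weyl_y : A := weyl_pi (free_y K).

Lemma weyl_rel : weyl_y * weyl_x - weyl_x * weyl_y = 1.
Proof.
rewrite -!weyl_piM -weyl_piB; apply/weyl_pi_eq; exact: weyl_relator_in.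
Qed.

Definition weyl_exchange (u : A) : A := weyl_pi (free_exchange (repr u)).

Lemma weyl_exchange_pi p : weyl_exchange (weyl_pi p) = weyl_pi (free_exchange p).
Proof.
apply/weyl_pi_eq; rewrite -free_exchangeB.
exact/free_exchange_ideal/weyl_repr_pi.
Qed.

Lemma weyl_exchange_linear : linear weyl_exchange.
Proof.
move=> c u v; rewrite -(weyl_piK u) -(weyl_piK v) -weyl_piZ -weyl_piD.
rewrite !weyl_exchange_pi -weyl_piZ -weyl_piD; congr weyl_pi.
by rewrite -free_exchangeZ /free_exchange raddfD.
Qed.

HB.instance Definition _ :=
  GRing.isLinear.Build K A A _ weyl_exchange weyl_exchange_linear.

Lemma weyl_exchangeM u v :
  weyl_exchange (u * v) = weyl_exchange v * weyl_exchange u.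
Proof.
rewrite -(weyl_piK u) -(weyl_piK v) -weyl_piM !weyl_exchange_pi.
by rewrite free_exchangeM weyl_piM.
Qed.

Lemma weyl_exchange_x : weyl_exchange weyl_x = weyl_y.
Proof. by rewrite weyl_exchange_pi free_exchange_x. Qed.

Lemma weyl_exchange_y : weyl_exchange weyl_y = weyl_x.
Proof. by rewrite weyl_exchange_pi free_exchange_y. Qed.

End WeylAlgebra.

Definition exchange_endomorphism (K : fieldType)
    (f : {lrmorphism weyl K -> weyl K}) : Prop :=
  forall w : weyl K, f (weyl_exchange w) = weyl_exchange (f w).

Definition exchange_automorphism (K : fieldType)
    (f : {lrmorphism weyl K -> weyl K}) : Prop :=
  exchange_endomorphism f /\ bijective f.

(* Main.v *)
(* Put X = x + y and D = (y - x) / 2, so that D X - X D = 1 and the exchange  *)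
(* involution is the formal adjoint X |-> X, D |-> - D.  The theorem reduces  *)
(* to: if Q P - P Q = 1 and Q is skew-adjoint then Q = c D with c a nonzero   *)
(* scalar, for then P - X / c commutes with D, hence is a polynomial in D.    *)
(*   This is proved by reducing the coefficients of P and Q modulo p^2 for    *)
(* some large prime p.  In characteristic p the centre of the Weyl algebra is *)
(* F_p[X^p, D^p], and it contains P^p = phi (X^p, D^p) and Q^p = psi (X^p,    *)
(* D^p).  Computing [Q^p, P^p] = p! modulo p^2 in two ways shows that (phi,   *)
(* psi) has Jacobian 1, while skewness makes psi odd in its second variable:  *)
(* the problem has become commutative.  A Newton polygon argument then gives  *)
(* psi = c D^p, so that Q = c D modulo p.                                     *)

From HB Require Import structures.
Require Import Defs.
From mathcomp Require Import all_boot all_order all_algebra.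
From mathcomp Require Import all_field ssrAC finmap boolp monalg.
From mathcomp Require Import zify ring lra.
Set Implicit Arguments.
Unset Strict Implicit.
Unset Printing Implicit Defensive.
Import Order.TTheory GRing.Theory Num.Theory.
Local Open Scope ring_scope.

(** * Reduction of finitely many scalars modulo squares of primes *)

(** A compatible endomorphism [f] is determined by [P = f X] and [Q = f D], with [Q P - P Q = 1] and
    [Q] skew-adjoint, and everything rests on [skew_partner]: [Q = c D]. Given this, [X] and [D] lie
    in the image of [f]. Injectivity is the simplicity of the Weyl algebra in characteristic 0, in
    the form of [dint_inj]: the commutators with [X] and [D] are derivations that lower degrees and
    preserve a kernel, so a nonzero kernel would contain a nonzero scalar.

    For [skew_partner], suppose that [Q] has a nonzero coefficient at some monomial other than [D].
    Only finitely many scalars occur, and [Zp2_specialization] maps the ring they generate to Z/p^2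
    for a large prime p, keeping that coefficient invertible: the ring is first specialized to a
    number field Q(z), and the minimal polynomial of z has roots modulo arbitrarily large primes,
    which Hensel's lemma lifts modulo p^2.

    Modulo p, the power P^p commutes with P and Q. The algebra has rank p^2 over its centre
    F_p[X^p, D^p], and the p^2 products P^s Q^t with s, t < p are independent over it, so P^p is
    central ([pair_power_central]), and likewise Q^p. Write them as phi(X^p, D^p) and psi(X^p, D^p).
    Modulo p^2, normal ordering gives [Q^p, P^p] = p! and [D^p, X^p] = p!. As (p!)^2 = 0 there, the
    first commutator is also p! times the Jacobian of (phi, psi) ([centre_poly_commutator]), which
    is therefore 1 modulo p ([jacobian_pair_power]).

    Since Q is skew and p is odd, psi is odd in its second variable. By [skew_jacobian_pair] psi is
    then a multiple of y: otherwise a common supporting direction of the Newton polygons of phi and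
    psi exhibits a nonconstant monomial of the Jacobian that nothing cancels, its integer factor
    being positive and at most d^2 < p. Thus Q^p is a multiple of D^p, and comparing leading terms
    makes Q a multiple of D modulo p, a contradiction. *)

Section EvaluationMorphism.
Variables (S R : comNzRingType) (f : {rmorphism S -> R}) (r : R).

Definition polyev (p : {poly S}) : R := (map_poly f p).[r].

Fact polyev_zmod_morphism : zmod_morphism polyev.
Proof. by move=> p q; rewrite /polyev rmorphB hornerD hornerN. Qed.

Fact polyev_monoid_morphism : monoid_morphism polyev.
Proof.
by split=> [|p q]; rewrite /polyev ?rmorph1 ?hornerC // rmorphM hornerM.
Qed.

HB.instance Definition _ :=
  GRing.isZmodMorphism.Build {poly S} R polyev polyev_zmod_morphism.
HB.instance Definition _ :=
  GRing.isMonoidMorphism.Build {poly S} R polyev polyev_monoid_morphism.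

Lemma polyevE p : polyev p = (map_poly f p).[r].
Proof. by []. Qed.

Lemma polyevC a : polyev a%:P = f a.
Proof. by rewrite /polyev map_polyC hornerC. Qed.

Lemma polyevX : polyev 'X = r.
Proof. by rewrite /polyev map_polyX hornerX. Qed.

Lemma polyevZ a p : polyev (a *: p) = f a * polyev p.
Proof. by rewrite -mul_polyC rmorphM /= polyevC. Qed.

End EvaluationMorphism.

(** This says that [h] factors through the subring [e(S)], without constructing that subring. *)
Definition specializes (S R R' : pzRingType) (e : S -> R) (h : S -> R') :=
  forall s, e s = 0 -> h s = 0.

(** * Algebraic relations over the image of a ring homomorphism *)

Section AlgebraicRelations.
Variables (S : comNzRingType) (K : idomainType) (e : {rmorphism S -> K}) (c : K).
Local Notation ev := (polyev e c).

(** Truncation discards the top coefficients killed by [e], so that the leading coefficient survives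
    in [K]. *)
Lemma size_map_lift (f : {poly S}) :
  exists2 g, map_poly e g = map_poly e f & size g = size (map_poly e f).
Proof.
set n := size (map_poly e f).
exists (take_poly n f).
  apply/polyP => i; rewrite !coef_map coef_take_poly.
  case: ltnP => // le. rewrite raddf0.
  by rewrite -coef_map nth_default.
apply/eqP; rewrite eqn_leq size_take_poly /=.
apply: leq_trans (size_poly _ _ : (size (map_poly e (take_poly n f)) <= _)%N).
rewrite eq_leq //; congr (size (polyseq _)); apply/polyP => i.
rewrite !coef_map coef_take_poly; case: ltnP => // le; rewrite raddf0.
by rewrite -coef_map nth_default.
Qed.

Lemma lead_coef_map_neq0 (f : {poly S}) :
  size f = size (map_poly e f) -> map_poly e f != 0 -> e (lead_coef f) != 0.
Proof. by move=> sf nz; rewrite lead_coefE -coef_map sf -lead_coefE lead_coef_eq0. Qed.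

Lemma polyev_map (f g : {poly S}) : map_poly e f = map_poly e g -> ev f = ev g.
Proof. by rewrite !polyevE => ->. Qed.

(** When [c] is algebraic over [e(S)], a nonzero element of [e(S)[c]] divides a nonzero element of
    [e(S)]. This is Euclid's algorithm on [f] and [t] with pseudo-division, by induction on the
    total size. *)
Lemma algebraic_multiple_aux n (f t : {poly S}) :
    (size f + size t <= n)%N ->
    ev f = 0 -> map_poly e f != 0 -> ev t != 0 ->
  exists u s, e s != 0 /\ ev (u * t) = e s.
Proof.
elim: n f t => [|n IH] f t.
  rewrite leqn0 addn_eq0 !size_poly_eq0 => /andP[/eqP-> _] _.
  by rewrite rmorph0 eqxx.
move=> le ef nf et.
have [f1 mf1 sf1] := size_map_lift f; have [t1 mt1 st1] := size_map_lift t.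
have lt1 : (size (map_poly e f) <= size f)%N by rewrite size_poly.
have lt2 : (size (map_poly e t) <= size t)%N by rewrite size_poly.
have [lt|] := ltnP (size f1 + size t1) (size f + size t).
  have [||||u [s [es eu]]] := IH f1 t1; rewrite ?mf1 ?(polyev_map mf1) ?(polyev_map mt1) //.
    by rewrite -ltnS; apply: leq_trans lt le.
  by exists u, s; split=> //; rewrite rmorphM /= -(polyev_map mt1) -rmorphM.
move=> ge.
have sf : size f = size (map_poly e f) by lia.
have st : size t = size (map_poly e t) by lia.
have lf := lead_coef_map_neq0 sf nf.
have nt : map_poly e t != 0.
  by apply: contraNneq et => t0; rewrite polyevE t0 horner0.
have lt := lead_coef_map_neq0 st nt.
have [/size1_polyC et0|st1'] := leqP (size t) 1.
  by exists 1, t`_0; split; rewrite ?mul1r -(polyevC e c) -et0.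
have tn0 : t != 0 by rewrite -size_poly_gt0; lia.
have fn0 : f != 0 by apply: contraNneq nf => ->; rewrite rmorph0.
have [le_ft|lt_tf] := leqP (size f) (size t).
  have eq := Pdiv.ComRing.rdivp_eq f t; have := Pdiv.Ring.ltn_rmodp t f.
  rewrite fn0; move: eq.
  set r := Pdiv.Ring.rmodp t f; set q := Pdiv.Ring.rdivp t f.
  set k := Pdiv.Ring.rscalp t f => eq ltr.
  have er : ev r = e (lead_coef f) ^+ k * ev t.
    have := congr1 ev eq; rewrite rmorphD rmorphM /= ef mulr0 add0r => <-.
    by rewrite polyevZ rmorphXn.
  have [||||u [s [es eu]]] := IH f r => //.
    by rewrite -ltnS; apply: leq_trans le; rewrite ltn_add2l; apply: leq_trans le_ft.
    by rewrite er mulf_neq0 ?expf_neq0.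
  exists (u * (lead_coef f ^+ k)%:P), s; split=> //.
  by rewrite -eu !rmorphM /= er polyevC rmorphXn mulrA.
have eq := Pdiv.ComRing.rdivp_eq t f; have := Pdiv.Ring.ltn_rmodp f t.
rewrite tn0; move: eq.
set r := Pdiv.Ring.rmodp f t; set q := Pdiv.Ring.rdivp f t.
set k := Pdiv.Ring.rscalp f t => eq ltr.
have er : ev r = - ev q * ev t.
  have := congr1 ev eq; rewrite rmorphD rmorphM /= polyevZ ef mulr0 => e0.
  by rewrite mulNr; apply/eqP; rewrite -addr_eq0 addrC -e0.
(* If the remainder vanishes at [c], then so does [q], and a smaller relation is at hand: [r] if it
   is nonzero over [K], and [q] otherwise. *)
have [er0|ern] := eqVneq (ev r) 0; last first.
  have [||||u [s [es eu]]] := IH f r => //.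
    by rewrite -ltnS; apply: leq_trans le; rewrite ltn_add2l.
  exists (- (u * q)), s; split=> //.
  by rewrite -eu !(rmorphM, rmorphN) /= er; ring.
have eq0 : ev q = 0.
  move/eqP: er; rewrite er0 eq_sym mulf_eq0 (negPf et) orbF oppr_eq0 => /eqP; exact.
have [mr0|mrn] := eqVneq (map_poly e r) 0; last first.
  by have [||||u [s ?]] := IH r t => //;
    [rewrite -ltnS; apply: leq_trans le; rewrite ltn_add2r; apply: ltn_trans lt_tf|exists u, s].
have mq : (e (lead_coef t) ^+ k) *: map_poly e f = map_poly e q * map_poly e t.
  have := congr1 (map_poly e) eq; rewrite rmorphD rmorphM /= mr0 addr0 => <-.
  by rewrite map_polyZ rmorphXn.
have mqn : map_poly e q != 0.
  apply: contraNneq nf => q0; move/eqP: mq; rewrite q0 mul0r -mul_polyC mulf_eq0 polyC_eq0.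
  by rewrite expf_eq0 (negPf lt) andbF.
have [q1 mq1 sq1] := size_map_lift q.
have [||||u [s ?]] := IH q1 t; rewrite ?mq1 ?(polyev_map mq1) //; last by exists u, s.
have := congr1 (fun p : {poly K} => size p) mq; rewrite size_mul // size_scale ?expf_neq0 //.
by rewrite sq1 -sf -st; lia.
Qed.

Lemma algebraic_multiple (f t : {poly S}) :
    ev f = 0 -> map_poly e f != 0 -> ev t != 0 ->
  exists u s, e s != 0 /\ ev (u * t) = e s.
Proof. exact: algebraic_multiple_aux (leqnn _). Qed.

(** A substitute for the minimal polynomial of [c]: pseudo-division by a relation of least degree
    generates all relations, up to powers of its leading coefficient and polynomials with
    coefficients killed by [e]. *)
Lemma minimal_relation (f : {poly S}) :
    ev f = 0 -> map_poly e f != 0 ->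
  exists m, [/\ ev m = 0, e (lead_coef m) != 0, (1 < size m)%N,
     forall g, ev g = 0 -> (size (map_poly e g) < size m)%N -> map_poly e g = 0
   & forall g, ev g = 0 -> exists k q r, lead_coef m ^+ k *: g = q * m + r /\ map_poly e r = 0].
Proof.
move=> ef nf.
pose P n := `[< exists g, [/\ ev g = 0, map_poly e g != 0 & size g = n] >].
have exP : exists n, P n by exists (size f); apply/asboolP; exists f.
case: (ex_minnP exP) => n /asboolP[m0 [em0 nm0 sm0]] minn.
have minP g : ev g = 0 -> (size (map_poly e g) < n)%N -> map_poly e g = 0.
  move=> eg lt; apply/eqP/negPn/negP => ng.
  have [g1 mg1 sg1] := size_map_lift g.
  have /minn : P (size g1) by apply/asboolP; exists g1; rewrite mg1 (polyev_map mg1).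
  by rewrite sg1 leqNgt lt.
have sm : size m0 = size (map_poly e m0).
  apply/eqP; rewrite eqn_leq size_poly andbT leqNgt sm0; apply/negP => lt.
  by move: nm0; rewrite minP ?eqxx.
have lm := lead_coef_map_neq0 sm nm0.
have s1 : (1 < size m0)%N.
  rewrite ltnNge; apply/negP => /size1_polyC em; move: em0 nm0.
  by rewrite em polyevC map_polyC /= => ->; rewrite polyC0 eqxx.
exists m0; split=> //; first by rewrite sm0.
move=> g eg.
have eq := Pdiv.ComRing.rdivp_eq m0 g; have := Pdiv.Ring.ltn_rmodp g m0.
have -> : m0 != 0 by rewrite -size_poly_gt0; lia.
move: eq; set r := Pdiv.Ring.rmodp g m0; set q := Pdiv.Ring.rdivp g m0.
set k := Pdiv.Ring.rscalp g m0 => eq ltr.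
exists k, q, r; split=> //; apply: minP.
  have := congr1 ev eq; rewrite rmorphD rmorphM /= polyevZ em0 eg !mulr0 add0r.
  by move=> <-.
by apply: leq_ltn_trans (size_poly _ _) _; rewrite -sm0.
Qed.

End AlgebraicRelations.

(** * Specialization to algebraic numbers *)

Lemma exists_nonroot (L : numDomainType) (p : {poly L}) :
  p != 0 -> exists n : nat, p.[n%:R] != 0.
Proof.
move=> pn0; apply: contrapT => all0.
have := max_poly_roots (rs := [seq n%:R | n <- iota 0 (size p)]) pn0.
rewrite size_map size_iota ltnn => H; apply/Bool.diff_false_true/H.
  apply/allP => _ /mapP[n _ ->]; apply: contrapT => /negP nz.
  by apply: all0; exists n.
rewrite map_inj_uniq ?iota_uniq // => m n /eqP; by rewrite eqr_nat => /eqP.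
Qed.

(** Iterated polynomial rings over Z present the finitely generated subrings of [K] and allow
    induction on the number of generators. *)
Inductive int_polyring : comNzRingType -> Prop :=
| int_polyring0 : int_polyring int
| int_polyringS S : int_polyring S -> int_polyring {poly S}.

(** A weak Nullstellensatz for [e(S)]: its homomorphisms to algebraic numbers separate nonzero
    elements from 0. *)
Definition algC_specializable (K : idomainType) (S : comNzRingType) (e : {rmorphism S -> K}) :=
  forall t, e t != 0 ->
  exists2 h : {rmorphism S -> algC}, specializes e h & h t != 0.

(** If [c] is algebraic, the variable goes to a root of the specialized minimal relation, and a
    multiple of [t] lying in [e(S)] is kept nonzero together with the leading coefficient. If [c] is
    transcendental, any value is allowed, and an integer avoiding the roots of the specialized [t]
    is taken. *)
Lemma algC_specializable_poly (K : idomainType) (S : comNzRingType) (e : {rmorphism S -> K}) (c : K) :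
  algC_specializable e -> algC_specializable (polyev e c : {rmorphism {poly S} -> K}).
Proof.
move=> spec t et.
have [[f [ef nf]]|transc] := pselect (exists f, polyev e c f = 0 /\ map_poly e f != 0).
  have [m [em lm sm mmin mgen]] := minimal_relation ef nf.
  have [u [s [es eu]]] := algebraic_multiple ef nf et.
  have [|h sh] := spec (s * lead_coef m); first by rewrite rmorphM mulf_neq0.
  rewrite rmorphM mulf_eq0 negb_or => /andP[hs hl].
  have [r r0] : exists r, root (map_poly h m) r.
    by apply/closed_rootP; rewrite size_map_poly_id0 //; case: (size m) sm => [|[]].
  have sh' : specializes (polyev e c) (polyev h r).
    move=> g /mgen[k [q [w [eq mw]]]].
    have hw : map_poly h w = 0.
      by apply/polyP => i; rewrite coef_map coef0; apply: sh; rewrite -coef_map mw coef0.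
    have := congr1 (polyev h r) eq.
    rewrite rmorphD rmorphM /= polyevZ (polyevE h r m) (eqP r0) mulr0 add0r.
    rewrite [X in _ = X]polyevE hw horner0 => /eqP.
    by rewrite mulf_eq0 rmorphXn expf_eq0 (negPf hl) andbF => /eqP.
  exists (polyev h r : {rmorphism {poly S} -> algC}) => //=.
  have e0 : polyev h r (u * t - s%:P) = 0.
    by apply: sh'; rewrite rmorphB /= eu polyevC subrr.
  apply: contraNneq hs => t0; move/eqP: e0.
  by rewrite rmorphB rmorphM /= t0 mulr0 sub0r oppr_eq0 polyevC.
have [i eti] : exists i, e t`_i != 0.
  apply: contrapT => all0; move/eqP: et; apply.
  rewrite /= polyevE; suff -> : map_poly e t = 0 by rewrite horner0.
  apply/polyP => i; rewrite coef_map coef0; apply: contrapT => /eqP nz.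
  by apply: all0; exists i.
have [h sh hti] := spec _ eti.
have [|n ht] := @exists_nonroot _ (map_poly h t).
  by apply: contraNneq hti => ht0; rewrite -coef_map ht0 coef0.
exists (polyev h n%:R : {rmorphism {poly S} -> algC}) => // g eg.
rewrite /= polyevE; suff -> : map_poly h g = 0 by rewrite horner0.
apply/polyP => j; rewrite coef_map coef0; apply: sh; rewrite -coef_map.
have -> : map_poly e g = 0; last by rewrite coef0.
apply: contrapT => /eqP ng; apply: transc; by exists g.
Qed.

Lemma intr_eq0_pchar0 (K : fieldType) (n : int) :
  [pchar K] =i pred0 -> (n%:~R == 0 :> K) = (n == 0).
Proof.
move=> /pcharf0P charK; case: n => n; first exact: charK.
by rewrite NegzE rmorphN !oppr_eq0; exact: charK.
Qed.

Lemma int_polyring_span (K : fieldType) (cs : seq K) : [pchar K] =i pred0 ->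
  exists (S : comNzRingType) (e : {rmorphism S -> K}),
    [/\ int_polyring S, algC_specializable e
      & forall c, c \in cs -> exists s, e s = c].
Proof.
move=> charK; elim: cs => [|c cs [S [e [fgS specS imS]]]].
  exists int, (intr : {rmorphism int -> K}); split=> //; first exact: int_polyring0.
  move=> t et; exists (intr : {rmorphism int -> algC}).
    by move=> s /eqP; rewrite /= intr_eq0_pchar0 // => /eqP->.
  by rewrite /= intr_eq0 -(intr_eq0_pchar0 _ charK).
exists {poly S}, (polyev e c : {rmorphism {poly S} -> K}); split.
- exact: int_polyringS.
- exact: algC_specializable_poly.
move=> d; rewrite inE => /orP[/eqP->|/imS[s <-]]; first by exists 'X; rewrite /= polyevX.
by exists s%:P; rewrite /= polyevC.
Qed.

Lemma rmorph_polyP (S R : comNzRingType) (h h' : {rmorphism {poly S} -> R}) :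
  (forall s, h s%:P = h' s%:P) -> h 'X = h' 'X -> h =1 h'.
Proof.
move=> hC hX p; elim/poly_ind: p => [|p s IH]; first by rewrite !rmorph0.
by rewrite !rmorphD !rmorphM /= IH hX hC.
Qed.

(** * Primitive elements and denominators *)

Local Notation pQtoC := (map_poly ratr : {poly rat} -> {poly algC}).

(* [z] is a primitive element of the field generated by the image of [h]. *)
Lemma int_polyring_primitive (S : comNzRingType) (h : {rmorphism S -> algC}) :
  int_polyring S ->
  exists z (G : {rmorphism S -> {poly rat}}), forall s, h s = (pQtoC (G s)).[z].
Proof.
move=> fgS; elim: fgS h => [|{}S _ IH] h.
  exists 0, (polyC \o intr : {rmorphism int -> {poly rat}}) => s /=.
  by rewrite map_polyC hornerC /= ratr_int -[s in LHS]intz rmorph_int.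
have [z [G hG]] := IH (h \o polyC).
have [z' _ [[|pz [|px [|]]]// [ez ec]]] := algC_PET [:: z; h 'X].
pose Gz := (comp_poly pz : {rmorphism {poly rat} -> {poly rat}}) \o G.
exists z', (polyev Gz px : {rmorphism {poly S} -> {poly rat}}).
pose evz := polyev (ratr : {rmorphism rat -> algC}) z'.
apply: (@rmorph_polyP _ _ h ((evz : {rmorphism {poly rat} -> algC}) \o (polyev Gz px : {rmorphism {poly S} -> {poly rat}}))) => [s|] /=.
  rewrite polyevC /evz polyevE /= map_comp_poly horner_comp -ez -hG //.
by rewrite polyevX /evz polyevE -ec.
Qed.

(** Morally [g s] is [G s] evaluated at [r], which makes sense once the finitely many denominators
    of the images of the generators are invertible. As [R] need not be a Q-algebra, this is
    expressed through an integral multiple [F] of [G s]. *)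
Lemma int_polyring_denominator (S : comNzRingType) (G : {rmorphism S -> {poly rat}}) :
  int_polyring S ->
  exists2 M : int, M != 0 &
    forall (R : comUnitRingType) (r : R), M%:~R \is a @GRing.unit R ->
    exists g : {rmorphism S -> R}, forall s, exists k (F : {poly int}),
      map_poly intr F = M%:~R ^+ k *: G s :> {poly rat} /\
      (map_poly intr F).[r] = M%:~R ^+ k * g s.
Proof.
move=> fgS; elim: fgS G => [|{}S _ IH] G.
  exists 1 => // R r _; exists (intr : {rmorphism int -> R}) => s.
  exists 0%N, s%:P; rewrite !expr0 scale1r mul1r !map_polyC hornerC /=; split=> //.
  by rewrite -[s in RHS]intz rmorph_int rmorph_int.
have [M Mn0 HM] := IH (G \o polyC).
have [B0 [a an0 eB]] := rat_poly_scale (G 'X).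
have aQ : a%:~R != 0 :> rat by rewrite intr_eq0.
have eB' : a%:~R *: G 'X = map_poly intr B0.
  by rewrite eB scalerA divff // scale1r.
exists (M * a); first by rewrite mulf_neq0.
move=> R r; rewrite rmorphM /= unitrM => /andP[uM ua].
have [g Hg] := HM R r uM.
pose b : R := a%:~R^-1 * (map_poly intr B0).[r].
exists (polyev g b : {rmorphism {poly S} -> R}); elim/poly_ind => [|p c [k [F [FG Fg]]]].
  exists 0%N, 0; rewrite !rmorph0 scaler0 mulr0 horner0; split=> //.
have [l [C [CG Cg]]] := Hg c.
exists (k + l).+1, (((M * a) ^+ l * M)%:P * F * B0 + ((M * a) ^+ k * M * a ^+ l.+1)%:P * C).
have mapC (n : int) : map_poly intr n%:P = (n%:~R)%:P :> {poly rat} by rewrite map_polyC.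
have mapCR (n : int) : map_poly intr n%:P = (n%:~R)%:P :> {poly R} by rewrite map_polyC.
have eb : a%:~R * b = (map_poly intr B0).[r] by rewrite /b mulrA divrr ?mul1r.
clearbody b.
split.
  rewrite -mul_polyC polyC_exp intrM polyCM in FG; rewrite -mul_polyC polyC_exp in CG.
  rewrite -mul_polyC in eB'.
  rewrite -mul_polyC polyC_exp intrM polyCM.
  rewrite !(rmorphD, rmorphM, rmorphXn) /= ?mapC FG CG -eB' /=.
  move: (G p) (G 'X) (G c%:P) ((M%:~R)%:P) ((a%:~R)%:P) => u v w x y.
  rewrite !exprS exprD !exprMn; ring.
have -> : (polyev g b : {rmorphism {poly S} -> R}) (p * 'X + c%:P) = polyev g b p * b + g c.
  by rewrite rmorphD rmorphM /= polyevC polyevX.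
have {}Fg : (map_poly intr F).[r] = (M%:~R * a%:~R) ^+ k * polyev g b p := Fg.
move: (polyev g b p) Fg => v Fg.
rewrite !(rmorphD, rmorphM, rmorphXn) /= !mapCR.
rewrite !hornerE Fg Cg -eb ?intrM.
move: (g c) (M%:~R : R) (a%:~R : R) => u x y.
rewrite !exprS exprD !exprMn; ring.
Qed.

(** * Roots of integer polynomials modulo p and p^2 *)

(** Schur's argument: with [c = f(0)] nonzero, the value of [f] at a multiple of [c B!] is [c k]
    with [k = 1] modulo [B!], so every prime factor of [k] exceeds [B]. *)
Lemma poly_prime_divisor (f : {poly int}) (B : nat) : (1 < size f)%N ->
  exists p (n : int), [/\ prime p, (B < p)%N & (p %| f.[n])%Z].
Proof.
move=> sf; pose q := drop_poly 1 f; pose c := f`_0.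
have ef x : f.[x] = c + q.[x] * x.
  rewrite -[f in LHS](poly_take_drop 1) hornerD hornerM hornerXn expr1.
  congr (_ + _); have /size1_polyC-> := size_take_poly 1 f.
  by rewrite hornerC coef_take_poly.
have root_case n : f.[n] = 0 -> exists p (n : int), [/\ prime p, (B < p)%N & (p %| f.[n])%Z].
  move=> fn0; have [p Bp pp] := prime_above B.
  by exists p, n; rewrite fn0 dvdz0.
have [c0|cn0] := eqVneq c 0; first by apply: (root_case 0); rewrite ef c0 mulr0.
pose b : int := c * (B`!)%:Z.
have bn0 : b != 0 by rewrite mulf_neq0 // -lt0n fact_gt0.
(* A non-root [n] of this polynomial ensures that [k] is not 1 or -1, hence has a prime factor
   unless it is 0. *)
have fcn0 : (f ^+ 2 - (c ^+ 2)%:P) \Po (b *: 'X) != 0.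
  rewrite -size_poly_gt0 size_comp_poly2 ?size_scale ?size_polyX //.
  rewrite size_poly_gt0 subr_eq0; apply/eqP => /(congr1 (fun p : {poly int} => (size p).-1)).
  by rewrite size_exp size_polyC; case: (size f) sf => [|[|m]] //; case: (_ != 0).
have [n hn] := exists_nonroot fcn0.
have [f0|fn0] := eqVneq f.[b * n%:R] 0; first exact: root_case f0.
pose k := 1 + q.[b * n%:R] * (B`!)%:Z * n%:R.
have ek : f.[b * n%:R] = c * k by rewrite ef /k /b; ring.
have kn1 : `|k|%N != 1%N.
  apply: contraNneq hn => k1; rewrite horner_comp !hornerE ek exprMn.
  have [->|->] : k = 1 \/ k = -1 by move: k1; clear; lia.
    by rewrite expr1n mulr1 subrr.
  by rewrite sqrrN expr1n mulr1 subrr.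
have kn0 : k != 0 by apply: contraNneq fn0 => k0; rewrite ek k0 mulr0.
have pp : prime (pdiv `|k|%N) by apply: pdiv_prime; lia.
exists (pdiv `|k|%N), (b * n%:R); split=> //; last first.
  by rewrite ek dvdz_mull // dvdzE absz_nat pdiv_dvd.
rewrite ltnNge; apply/negP => le.
have : (pdiv `|k|%N %| k - q.[b * n%:R] * (B`!)%:Z * n%:R)%Z.
  rewrite rpredB //; first by rewrite dvdzE absz_nat pdiv_dvd.
  rewrite dvdz_mulr // dvdz_mull // dvdzE !absz_nat dvdn_fact //.
  by rewrite prime_gt0 //= le.
by rewrite /k addrK dvdzE absz_nat dvdn1 => /eqP p1; rewrite p1 in pp.
Qed.

Lemma horner_taylor2 (R : comNzRingType) (p : {poly R}) (x h : R) :
  exists c, p.[x + h] = p.[x] + p^`().[x] * h + c * h ^+ 2.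
Proof.
elim/poly_ind: p => [|p a [c IH]].
  by exists 0; rewrite deriv0 !horner0 !mul0r !addr0.
exists (c * (x + h) + p^`().[x]); rewrite derivMXaddC !hornerMXaddC hornerD hornerMX IH; ring.
Qed.

Section ModuloSquareOfPrime.
Variables (p : nat) (pr_p : prime p).
Local Notation R := 'Z_(p ^ 2).

Lemma sqr_prime_gt1 : (1 < p ^ 2)%N.
Proof. by rewrite -(exp1n 2) ltn_exp2r // prime_gt1. Qed.

Lemma intr_unit_Zp2 (k : int) : ~~ (p %| k)%Z -> (k%:~R : R) \is a GRing.unit.
Proof.
rewrite dvdzE absz_nat => ndv.
have u : (`|k|%N%:R : R) \is a GRing.unit.
  by rewrite unitZpE ?sqr_prime_gt1 // coprime_pexpl // prime_coprime.
have [e|e] : k = `|k|%N :> int \/ k = - (`|k|%N%:Z) by lia.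
  by rewrite e; exact: u.
by rewrite e rmorphN unitrN; exact: u.
Qed.

Lemma intr_dvd_Zp2 (k : int) : (p %| k)%Z -> (k%:~R : R) ^+ 2 = 0.
Proof.
case/dvdzP => q ->; rewrite intrM exprMn.
have -> : (p%:~R : R) ^+ 2 = (p ^ 2)%N%:R by rewrite natrX.
by rewrite pchar_Zp ?sqr_prime_gt1 // mulr0.
Qed.

(** A single Newton step suffices: the correction [h] is a multiple of p, so the Taylor remainder, a
    multiple of [h ^+ 2], vanishes. *)
Lemma hensel_Zp2 (f : {poly int}) (n : int) :
  (p %| f.[n])%Z -> ~~ (p %| f^`().[n])%Z ->
  exists r : R, (map_poly intr f).[r] = 0.
Proof.
move=> f0 f1; pose x : R := n%:~R.
have ev (g : {poly int}) : (map_poly intr g).[x] = g.[n]%:~R :> R by rewrite horner_map.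
have u := intr_unit_Zp2 f1.
pose h : R := - (f.[n]%:~R / f^`().[n]%:~R).
have [c ec] := horner_taylor2 (map_poly intr f) x h.
exists (x + h); rewrite ec deriv_map !ev /h mulrN mulrCA divrr // mulr1 subrr add0r.
by rewrite sqrrN exprMn intr_dvd_Zp2 // mul0r mulr0.
Qed.

End ModuloSquareOfPrime.

Lemma algC_int_relation (z : algC) :
  exists f : {poly int}, polyev (intr : {rmorphism int -> algC}) z f = 0 /\
    map_poly (intr : int -> algC) f != 0.
Proof.
have [q [eq monq] _] := minCpolyP z.
have [f [a an0 ef]] := rat_poly_scale q.
have ez : (pQtoC q).[z] = 0 by rewrite -eq; apply/eqP/root_minCpoly.
have eC : map_poly intr f = a%:~R *: pQtoC q.
  have -> : map_poly intr f = pQtoC (map_poly intr f).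
    by rewrite -map_poly_comp; apply: eq_map_poly => i /=; rewrite ratr_int.
  by rewrite ef map_polyZ /= fmorphV /= ratr_int scalerA divff ?scale1r // intr_eq0.
exists f; rewrite polyevE eC hornerZ ez mulr0; split=> //.
rewrite scaler_eq0 intr_eq0 (negPf an0) /= map_poly_eq0.
exact: monic_neq0.
Qed.

(* Map the subring generated by [cs] to a ring Z[1/M][z] of algebraic        *)
(* numbers, then send z to a root modulo p^2 of its minimal polynomial.      *)
Theorem Zp2_specialization (K : fieldType) (cs : seq K) : [pchar K] =i pred0 ->
  exists (S : comNzRingType) (e : {rmorphism S -> K}),
    (forall c, c \in cs -> exists s, e s = c) /\
    forall t B, e t != 0 -> exists p, [/\ prime p, (B < p)%N &
      exists2 g : {rmorphism S -> 'Z_(p ^ 2)}, specializes e g & g t \is a GRing.unit].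
Proof.
move=> charK; have [S [e [fgS specS imS]]] := int_polyring_span cs charK.
exists S, e; split=> // t B et.
have [h sh ht] := specS t et.
have [z [G hG]] := int_polyring_primitive h fgS.
have [M Mn0 HM] := int_polyring_denominator G fgS.
pose evz := polyev (intr : {rmorphism int -> algC}) z.
have [f0 [ef0 nf0]] := algC_int_relation z.
have [f [ef lf sf fmin fgen]] := minimal_relation ef0 nf0.
have mult (F : {poly int}) : evz F != 0 -> exists u (s : int), s != 0 /\ evz (u * F) = s%:~R.
  by move=> eF; have [u [s []]] := algebraic_multiple ef0 nf0 eF; rewrite intr_eq0; exists u, s.
have gen (F : {poly int}) : evz F = 0 -> exists k q, lead_coef f ^+ k *: F = q * f.
  move=> /fgen[k [q [r [eq r0]]]]; exists k, q; rewrite eq.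
  suff -> : r = 0 by rewrite addr0.
  apply/polyP => i; apply/eqP; rewrite coef0 -(intr_eq0 algC).
  by rewrite -[_%:~R]/(intr r`_i) -(coef_map (intr : {rmorphism int -> algC})) r0 coef0.
have lfn0 : lead_coef f != 0 by rewrite -(intr_eq0 algC).
(* By minimality of [f] its derivative does not vanish at [z], so it divides a nonzero integer [N'].
   A prime not dividing [N'] leaves the roots of [f] simple. *)
have [V [N' [N'n0 eV]]] : exists u (s : int), s != 0 /\ evz (u * f^`()) = s%:~R.
  have fn0 : f != 0 by rewrite -lead_coef_eq0.
  apply: mult; apply/eqP => /fmin.
  move=> /(_ (leq_ltn_trans (size_poly _ _) (lt_size_deriv fn0))).
  move=> /(congr1 (fun g : {poly algC} => g`_(size f).-2)).
  rewrite coef_map coef0 coef_deriv; case: (size f) sf lfn0 (lead_coefE f) => [|[|m]] //= _ lfn0 <-.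
  by move=> /eqP; rewrite /= intr_eq0 mulrn_eq0 (negPf lfn0).
have [T [a an0 eT]] := rat_poly_scale (G t).
have eT' : map_poly intr T = a%:~R *: G t by rewrite eT scalerA divff ?scale1r ?intr_eq0.
have evT (F : {poly int}) : evz F = (pQtoC (map_poly intr F)).[z].
  by rewrite /evz polyevE -map_poly_comp; congr (_.[z]); apply: eq_map_poly => i /=; rewrite ratr_int.
have [U [N [Nn0 eU]]] : exists u (s : int), s != 0 /\ evz (u * T) = s%:~R.
  by apply: mult; rewrite evT eT' map_polyZ /= ratr_int hornerZ -hG mulf_neq0 ?intr_eq0.
(* The prime must avoid the denominators [M], the leading coefficient used in pseudo-division by
   [f], the obstruction [N'] to Hensel's lemma, and [N], which makes the image of [t] a unit. *)
pose bad := M * lead_coef f * N' * N.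
have badn0 : bad != 0 by rewrite !mulf_neq0.
have [p [n [pr_p Bp pfn]]] := poly_prime_divisor (B + `|bad|) sf.
have nbad : ~~ (p %| bad)%Z.
  rewrite dvdzE absz_nat; apply/negP => /dvdn_leq; rewrite absz_gt0 badn0 => /(_ isT) le.
  by have := leq_trans Bp le; rewrite ltnNge leq_addl.
have ndv (c d : int) : bad = c * d -> ~~ (p %| c)%Z.
  by move=> e1; apply: contra nbad => pc; rewrite e1 dvdz_mulr.
have npM : ~~ (p %| M)%Z by apply: (ndv _ (lead_coef f * N' * N)); rewrite /bad; ring.
have npl : ~~ (p %| lead_coef f)%Z by apply: (ndv _ (M * N' * N)); rewrite /bad; ring.
have npN' : ~~ (p %| N')%Z by apply: (ndv _ (M * lead_coef f * N)); rewrite /bad; ring.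
have npN : ~~ (p %| N)%Z by apply: (ndv _ (M * lead_coef f * N')); rewrite /bad; ring.
have nplX k : ~~ (p %| lead_coef f ^+ k)%Z.
  rewrite dvdzE abszX absz_nat; case: k => [|k].
    by rewrite expn0 dvdn1; apply: contraTneq pr_p => ->.
  by rewrite Euclid_dvdX //; move: npl; rewrite dvdzE absz_nat => /negPf->.
have nf1 : ~~ (p %| f^`().[n])%Z.
  have [k [q eq]] : exists k q, lead_coef f ^+ k *: (V * f^`() - N'%:P) = q * f.
    by apply: gen; rewrite /evz rmorphB /= -/(evz _) eV polyevC subrr.
  have := congr1 (horner^~ n) eq; rewrite !hornerE => en.
  have {}en : lead_coef f ^+ k * N' = lead_coef f ^+ k * (V.[n] * f^`().[n]) - q.[n] * f.[n].
    by rewrite -en; ring.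
  apply/negP => pf1.
  have : (p %| lead_coef f ^+ k * N')%Z.
    by rewrite en rpredB // dvdz_mull // dvdz_mull.
  move: (nplX k) npN'; rewrite !dvdzE abszM absz_nat Euclid_dvdM //.
  by move=> /negPf-> /negPf->.
have [r r0] := hensel_Zp2 pr_p pfn nf1.
have [g Hg] := HM _ r (intr_unit_Zp2 pr_p npM).
have lu k : (lead_coef f ^+ k)%:~R \is a @GRing.unit 'Z_(p ^ 2) := intr_unit_Zp2 pr_p (nplX k).
(* Every integral relation of [z] holds for [r], because it is a multiple of [f] up to an invertible
   scalar. *)
have genR (F : {poly int}) : evz F = 0 -> (map_poly intr F).[r] = 0 :> 'Z_(p ^ 2).
  move=> /gen[k [q eq]]; apply: (mulrI (lu k)); rewrite mulr0.
  have := congr1 (fun F : {poly int} => (map_poly intr F).[r] : 'Z_(p ^ 2)) eq.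
  by rewrite map_polyZ hornerZ rmorphM hornerM r0 mulr0.
have Mu k : (M%:~R ^+ k : 'Z_(p ^ 2)) \is a GRing.unit by rewrite unitrX // intr_unit_Zp2.
exists p; split=> //; first exact: leq_ltn_trans (leq_addr _ _) Bp.
exists g.
  move=> s /sh hs; have [k [F [FG Fg]]] := Hg s.
  apply: (mulrI (Mu k)); rewrite mulr0 -Fg genR // evT FG map_polyZ hornerZ -hG hs mulr0 //.
have [k [F [FG Fg]]] := Hg t.
have eFT : a *: F = M ^+ k *: T.
  apply: (@map_inj_poly _ _ (intr : int -> rat)) => //; first exact: intr_inj.
  by rewrite !map_polyZ /= FG eT' rmorphXn !scalerA mulrC.
have : (map_poly intr (U * T)).[r] = N%:~R :> 'Z_(p ^ 2).
  apply/eqP; rewrite -subr_eq0; apply/eqP.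
  have := @genR (U * T - N%:P); rewrite rmorphB /= map_polyC !hornerE; apply.
  by rewrite /evz rmorphB /= -/(evz _) eU polyevC subrr.
move=> eUT; have : (N%:~R : 'Z_(p ^ 2)) \is a GRing.unit := intr_unit_Zp2 pr_p npN.
rewrite -eUT rmorphM hornerM unitrM => /andP[_ uT].
have := congr1 (fun F : {poly int} => (map_poly intr F).[r] : 'Z_(p ^ 2)) eFT.
rewrite !map_polyZ !hornerZ Fg rmorphXn => e1.
have : (M%:~R ^+ k * (map_poly intr T).[r] : 'Z_(p ^ 2)) \is a GRing.unit.
  by rewrite unitrM Mu.
by rewrite -e1 !unitrM => /and3P[].
Qed.

(** * Jacobian pairs of polynomials *)

(* The coefficient of x^m y^n in (b_y a_x - b_x a_y), where a and b are the   *)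
(* polynomials with coefficients [a i j] and [b i j] at x^i y^j, i, j <= d.  *)
Section JacobianCoefficients.
Variables (R : comNzRingType) (d : nat) (a b : nat -> nat -> R).

Definition jacobian_term (i j k l : nat) : R :=
  b i j * a k l * ((j * k)%:R - (l * i)%:R).

Definition jacobian_coef (m n : nat) : R :=
  \sum_(i < d.+1) \sum_(j < d.+1) \sum_(k < d.+1) \sum_(l < d.+1)
    (if (i + k == m.+1)%N && (j + l == n.+1)%N
     then jacobian_term i j k l else 0).

End JacobianCoefficients.

Section SkewJacobianPairs.
Variables (F : fieldType) (d : nat) (a b : nat -> nat -> F).
Hypothesis charF : forall n : nat, (0 < n <= d ^ 2)%N -> n%:R != 0 :> F.
Hypothesis a_supp : forall i j, a i j != 0 -> (i <= d)%N && (j <= d)%N.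
Hypothesis b_supp : forall i j, b i j != 0 -> (i <= d)%N && (j <= d)%N.
Hypothesis b_odd : forall i j, ~~ odd j -> b i j = 0.

Local Notation jacobian_term := (jacobian_term a b).
Local Notation jacobian_coef := (jacobian_coef d a b).

Lemma jacobian_coef_unique m n i j k l :
    b i j != 0 -> a k l != 0 -> (i + k = m.+1)%N -> (j + l = n.+1)%N ->
    (forall i' j' k' l', b i' j' != 0 -> a k' l' != 0 ->
       (i' + k' = m.+1)%N -> (j' + l' = n.+1)%N ->
       jacobian_term i' j' k' l' != 0 -> (i', j') = (i, j)) ->
  jacobian_coef m n = jacobian_term i j k l.
Proof.
move=> bij akl ik jl uniq.
have [/andP[ui uj] /andP[uk ul]] := (b_supp bij, a_supp akl).
have zero i' j' k' l' : (i', j') != (i, j) \/ (k', l') != (k, l) ->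
    (if (i' + k' == m.+1)%N && (j' + l' == n.+1)%N
     then jacobian_term i' j' k' l' else 0) = 0.
  case: ifP => // /andP[/eqP ik' /eqP jl'] neq.
  apply/eqP; apply: contraT => nz.
  have bij' : b i' j' != 0.
    by apply: contraNneq nz => b0; rewrite /jacobian_term b0 !mul0r.
  have akl' : a k' l' != 0.
    by apply: contraNneq nz => a0; rewrite /jacobian_term a0 mulr0 mul0r.
  have [ei ej] := uniq _ _ _ _ bij' akl' ik' jl' nz.
  have [ek el] : k' = k /\ l' = l by lia.
  by case: neq; rewrite ?ei ?ej ?ek ?el eqxx.
have neqP (x y : 'I_d.+1) (z : nat) : (y : nat) = z -> x != y -> (x : nat) != z.
  by move=> <-; apply: contra => /eqP e; apply/eqP/val_inj.
rewrite /jacobian_coef (bigD1 (Ordinal (ui : (i < d.+1)%N))) //=.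
rewrite [X in _ + X]big1 ?addr0 => [|i' ni].
  rewrite (bigD1 (Ordinal (uj : (j < d.+1)%N))) //=.
  rewrite [X in _ + X]big1 ?addr0 => [|j' nj].
    rewrite (bigD1 (Ordinal (uk : (k < d.+1)%N))) //=.
    rewrite [X in _ + X]big1 ?addr0 => [|k' nk].
      rewrite (bigD1 (Ordinal (ul : (l < d.+1)%N))) //=.
      rewrite [X in _ + X]big1 ?addr0 => [|l' nl].
        by rewrite ik jl !eqxx.
      apply: zero; right; apply: contraNneq nl => -[el]; exact/eqP/val_inj.
    rewrite big1 // => l' _; apply: zero; right.
    apply: contraNneq nk => -[ek _]; exact/eqP/val_inj.
  rewrite big1 // => k' _; rewrite big1 // => l' _; apply: zero; left.
  apply: contraNneq nj => -[ej]; exact/eqP/val_inj.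
rewrite big1 // => j' _; rewrite big1 // => k' _; rewrite big1 // => l' _.
apply: zero; left; apply: contraNneq ni => -[ei _]; exact/eqP/val_inj.
Qed.

Hypothesis jacobian1 :
  forall m n, jacobian_coef m n = ((m == 0%N) && (n == 0%N))%:R.

(** The integer [jk - li] lies between 1 and [d ^ 2], the range in which [charF] makes it
    nonzero. *)
Lemma jacobian_term0 i j k l :
  b i j != 0 -> a k l != 0 -> (l * i < j * k)%N -> jacobian_term i j k l != 0.
Proof.
move=> bij akl lt.
rewrite /jacobian_term mulf_neq0 // ?mulf_neq0 // -natrB ?charF //; last by lia.
have := a_supp akl; have := b_supp bij; nia.
Qed.

(* A unique pair of exponents contributing to a coefficient of the Jacobian *)
(* contributes to its constant coefficient.                                 *)
Lemma jacobian_extremal i j k l :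
    b i j != 0 -> a k l != 0 -> (l * i < j * k)%N ->
    (forall i' j' k' l', b i' j' != 0 -> a k' l' != 0 ->
       (i' + k' = i + k)%N -> (j' + l' = j + l)%N ->
       jacobian_term i' j' k' l' != 0 -> (i', j') = (i, j)) ->
  (i + k = 1)%N /\ (j + l = 1)%N.
Proof.
move=> bij akl lt uniq.
have [m em] : exists m, (i + k = m.+1)%N by exists (i + k).-1; nia.
have [n en] : exists n, (j + l = n.+1)%N by exists (j + l).-1; nia.
have := jacobian1 m n.
rewrite (jacobian_coef_unique bij akl em en) => [/eqP|]; last first.
  by rewrite -em -en.
have := jacobian_term0 bij akl lt.
case: m em => [|m] em; last by move=> /negPf->.
by case: n en => [|n] en //= /negPf->.
Qed.

Lemma exists_top (s : nat -> F) : (exists2 i, s i != 0 & (0 < i)%N) ->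
  (forall i, s i != 0 -> (i <= d)%N) ->
  exists i, [/\ s i != 0, (0 < i)%N & forall k, s k != 0 -> (k <= i)%N].
Proof.
move=> [i0 si0 i0_gt0] bound.
have ex : exists i, (s i != 0) && (0 < i)%N by exists i0; rewrite si0.
have le i : (s i != 0) && (0 < i)%N -> (i <= d)%N by case/andP=> /bound.
case: (ex_maxnP ex le) => i /andP[si igt0] imax.
exists i; split=> // k sk; case: k sk => // k sk; exact/imax/andP.
Qed.

(** The constant coefficient of the Jacobian is [b01 a10 - b10 a01], and [b10 = 0] by oddness. *)
Lemma b01_a10 : b 0 1 != 0 /\ a 1 0 != 0.
Proof.
have j00 := jacobian1 0 0.
have nz : jacobian_coef 0 0 != 0 by rewrite j00 oner_eq0.
case: (eqVneq (b 0 1 * a 1 0) 0) => [ba0|]; last by rewrite mulf_eq0 negb_or => /andP.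
case/eqP: nz; rewrite /jacobian_coef big1 // => i _; rewrite big1 // => j _.
rewrite big1 // => k _; rewrite big1 // => l _.
case: ifP => // /andP[/eqP ik /eqP jl]; rewrite /jacobian_term.
have [ej|ej] : j = 1%N :> nat /\ l = 0%N :> nat \/ ~~ odd j by case: (j : nat) jl => [|[|]]; lia.
  case: ej => -> ->; have [[-> ->]|[-> ->]] : i = 0%N :> nat /\ k = 1%N :> nat \/ i = 1%N :> nat /\ k = 0%N :> nat by lia.
    by rewrite ba0 mul0r.
  by rewrite mul1n mul0n subrr mulr0.
by rewrite b_odd // !mul0r.
Qed.

(** Since [j] is odd, [j + l = 1] forces [j = 1] and [l = 0]. The rightmost exponents of these two
    rows then form an unrivalled pair, and [jacobian_extremal] gives [i + k = 1]. *)
Lemma bottom_row : (forall i, b i 1 != 0 -> i = 0%N) /\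
                   (forall k, a k 0 != 0 -> (k <= 1)%N).
Proof.
have [b01 a10] := b01_a10.
have [k [ak k_gt0 kmax]] : exists k, [/\ a k 0 != 0, (0 < k)%N & forall k', a k' 0 != 0 -> (k' <= k)%N].
  apply: (@exists_top (a^~ 0%N)) => [|k /a_supp/andP[]//].
  by exists 1%N.
have [i [bi imax]] : exists i, b i 1 != 0 /\ forall i', b i' 1 != 0 -> (i' <= i)%N.
  have le i : b i 1 != 0 -> (i <= d)%N by move=> /b_supp/andP[].
  have ex : exists i, b i 1 != 0 by exists 0%N.
  by case: (ex_maxnP ex le) => i bi imax; exists i.
have lt : (0 * i < 1 * k)%N by lia.
have [|ik _] := jacobian_extremal bi ak lt.
  move=> i' j' k' l' bij akl ei ej _.
  have oj : odd j' by apply: contraT => /(b_odd i')/eqP; rewrite (negPf bij).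
  have ej1 : j' = 1%N by lia.
  have el0 : l' = 0%N by lia.
  rewrite ej1 el0 in bij akl *.
  have := imax _ bij; have := kmax _ akl => *; congr pair; lia.
split=> [i' /imax|k' /kmax]; lia.
Qed.

Definition slope (n m : nat) : rat := n%:R / m%:R.

Lemma slope_le n m (tau : rat) :
  (0 < m)%N -> (slope n m <= tau) = (n%:R <= tau * m%:R).
Proof. by move=> m_gt0; rewrite ler_pdivrMr // ltr0n. Qed.

(* Otherwise take the largest slope [tau] of a segment joining the exponent *)
(* (1,0) of [a], or (0,1) of [b], to another exponent.  The linear form     *)
(* [i - tau j], with ties broken by [j], then singles out one exponent of   *)
(* each of [a] and [b], and their contributions to the Jacobian survive.    *)
Theorem skew_jacobian_pair i j : b i j != 0 -> i = 0%N /\ j = 1%N.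
Proof.
have [b01 a10] := b01_a10; have [b1 a0] := bottom_row.
move=> bij; case: (leqP j 1) => [j_le1|j_gt1].
  have ej : j = 1%N.
    by case: j j_le1 bij => [|[|//]] // _; rewrite b_odd ?eqxx.
  by split=> //; apply: b1; rewrite -ej.
exfalso.
(* The slopes from (0,1) to the exponents (u,v) of [b] with v > 1, followed by those from (1,0) to
   the exponents of [a] off the axes. *)
pose S := [seq slope p.1 p.2.-1 | p <- [seq (u, v) | u <- iota 0 d.+1, v <- iota 0 d.+1] & (b p.1 p.2 != 0) && (1 < p.2)%N]
  ++ [seq slope p.1.-1 p.2 | p <- [seq (u, v) | u <- iota 0 d.+1, v <- iota 0 d.+1] & [&& a p.1 p.2 != 0, (0 < p.1)%N & (0 < p.2)%N]].
have box (u v : nat) : (u <= d)%N && (v <= d)%N ->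
    (u, v) \in [seq (u, v) | u <- iota 0 d.+1, v <- iota 0 d.+1].
  by move=> /andP[ud vd]; apply: allpairs_f; rewrite mem_iota.
have Sb u v : b u v != 0 -> (1 < v)%N -> slope u v.-1 \in S.
  move=> buv v1; rewrite mem_cat; apply/orP; left; apply/mapP; exists (u, v) => //.
  by rewrite mem_filter /= buv v1 box // b_supp.
have Sa u v : a u v != 0 -> (0 < u)%N -> (0 < v)%N -> slope u.-1 v \in S.
  move=> auv u0 v0; rewrite mem_cat; apply/orP; right; apply/mapP; exists (u, v) => //.
  by rewrite mem_filter /= auv u0 v0 box // a_supp.
have [tau tauS tau_max] : exists2 tau, tau \in S & forall s, s \in S -> s <= tau.
  have := Sb _ _ bij j_gt1; move: S {Sa Sb} => S.
  elim: S (slope i j.-1) => // s S IH s0; rewrite inE => _.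
  case: S IH => [|s1 S] IH; first by exists s; rewrite ?mem_head // => s'; rewrite inE => /eqP->.
  have [tau tS tmax] := IH s1 (mem_head _ _).
  have [le|lt] := lerP s tau.
    exists tau; first by rewrite in_cons tS orbT.
    by move=> s'; rewrite in_cons => /orP[/eqP->|/tmax].
  exists s; rewrite ?mem_head // => s'; rewrite in_cons => /orP[/eqP->//|/tmax]; lra.
have tau_ge0 : 0 <= tau.
  apply: le_trans (tau_max _ (Sb _ _ bij j_gt1)).
  by rewrite divr_ge0 ?ler0n.
(* On [b] the form [u - tau v] is maximal at (0,1), where it is [- tau]; next, on [a] it is maximal
   at (1,0), where it is 1. *)
have wb u v : b u v != 0 -> u%:R - tau * v%:R <= - tau.
  move=> buv; case: (ltnP 1 v) => v1.
    have := tau_max _ (Sb _ _ buv v1); rewrite slope_le; last by lia.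
    have -> : v%:R = v.-1%:R + 1 :> rat by rewrite natr1; congr (_%:R); lia.
    lra.
  have ev : v = 1%N.
    by case: v v1 buv => [|[|//]] // _; rewrite b_odd ?eqxx.
  have eu : u = 0%N by apply: b1; rewrite -ev.
  by rewrite ev eu; lra.
have wa u v : a u v != 0 -> u%:R - tau * v%:R <= 1.
  move=> auv; case: (posnP u) => [->|u0].
    by have := mulr_ge0 tau_ge0 (ler0n _ v); lra.
  case: (posnP v) => [ev|v0].
    rewrite ev mulr0 subr0 -[1]/(1%:R) ler_nat; apply: a0; by rewrite -ev.
  have := tau_max _ (Sa _ _ auv u0 v0); rewrite slope_le //.
  have -> : u%:R = u.-1%:R + 1 :> rat by rewrite natr1; congr (_%:R); lia.
  lra.
(* Row [v] contains an exponent on the maximal edge of [b], respectively of [a] for [ona]. *)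
pose onb (v : nat) := [exists u : 'I_d.+1, (b u v != 0) && (u%:R - tau * v%:R == - tau)].
pose ona (v : nat) := [exists u : 'I_d.+1, (a u v != 0) && (u%:R - tau * v%:R == 1)].
have onbP (u v : nat) : b u v != 0 -> u%:R - tau * v%:R = - tau -> onb v.
  move=> buv e; apply/existsP.
  have /andP[ud _] := b_supp buv.
  by exists (Ordinal (ud : (u < d.+1)%N)); rewrite /= buv e eqxx.
have onaP (u v : nat) : a u v != 0 -> u%:R - tau * v%:R = 1 -> ona v.
  move=> buv e; apply/existsP.
  have /andP[ud _] := a_supp buv.
  by exists (Ordinal (ud : (u < d.+1)%N)); rewrite /= buv e eqxx.
have onb1 : onb 1 by apply: (onbP 0%N) => //; lra.
have ona0 : ona 0 by apply: (onaP 1%N) => //; rewrite mulr0 subr0.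
have onb_le v : onb v -> (v <= d)%N by case/existsP=> u /andP[/b_supp/andP[]].
have ona_le v : ona v -> (v <= d)%N by case/existsP=> u /andP[/a_supp/andP[]].
case: (ex_maxnP (ex_intro onb _ onb1) onb_le) => j0 /existsP[i0 /andP[b0 /eqP wb0]] j0max.
case: (ex_maxnP (ex_intro ona _ ona0) ona_le) => l0 /existsP[k0 /andP[ak0 /eqP wa0]] l0max.
have j0_gt0 := j0max _ onb1.
(* As [tau] is attained, at least one of the two edges rises above its starting point. *)
have big_jl : (1 < j0 + l0)%N.
  move: tauS; rewrite mem_cat => /orP[] /mapP[[u v]]; rewrite mem_filter /=.
    move=> /andP[/andP[buv v1] _] etau.
    suff /j0max : onb v by lia.
    apply: (onbP u) => //; rewrite etau /slope.
    have -> : v%:R = v.-1%:R + 1 :> rat by rewrite natr1; congr (_%:R); lia.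
    field. by rewrite pnatr_eq0; lia.
  move=> /andP[/and3P[auv u0 v0] _] etau.
  suff /l0max : ona v by lia.
  apply: (onaP u) => //; rewrite etau /slope.
  have -> : u%:R = u.-1%:R + 1 :> rat by rewrite natr1; congr (_%:R); lia.
  field. by rewrite pnatr_eq0; lia.
(* On the edges the determinant [j0 k0 - l0 i0] equals [j0 + tau l0]. *)
have det : (l0 * i0 < j0 * k0)%N.
  rewrite -(ltr_nat rat) !natrM.
  have ei : (i0 : nat)%:R = tau * j0%:R - tau by lra.
  have ek : (k0 : nat)%:R = 1 + tau * l0%:R by lra.
  rewrite ei ek.
  have : 1 <= j0%:R :> rat by rewrite -[1]/(1%:R) ler_nat.
  have := mulr_ge0 tau_ge0 (ler0n _ l0); lra.
have [|_] := jacobian_extremal b0 ak0 det; last by lia.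
(* A competing pair has the same total weight, so both of its members lie on the edges. Their rows
   are at most [j0] and [l0] with the same sum, which determines them. *)
move=> i' j' k' l' bij' akl' ei ej _.
have eR : i'%:R + k'%:R = (i0 : nat)%:R + (k0 : nat)%:R :> rat by rewrite -!natrD ei.
have eR2 : j'%:R + l'%:R = j0%:R + l0%:R :> rat by rewrite -!natrD ej.
have eT : tau * j'%:R + tau * l'%:R = tau * j0%:R + tau * l0%:R.
  by rewrite -!mulrDr eR2.
have wb' := wb _ _ bij'; have wa' := wa _ _ akl'.
have eb : i'%:R - tau * j'%:R = - tau by lra.
have ea : k'%:R - tau * l'%:R = 1 by lra.
have := j0max _ (onbP _ _ bij' eb); have := l0max _ (onaP _ _ akl' ea) => ll jj.
have ejj : j' = j0 by move: ll jj ej; clear; lia.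
by congr pair => //; apply/eqP; rewrite -(eqr_nat rat); apply/eqP; rewrite ejj in eb; lra.
Qed.

End SkewJacobianPairs.

(** * The Weyl algebra over a commutative ring *)

(* The Weyl algebra over R, as normally ordered polynomials: the coefficient *)
(* of X^i D^j is [a`_j`_i].                                                 *)
Definition diffop (R : comNzRingType) : Type := {poly {poly R}}.

HB.instance Definition _ (R : comNzRingType) :=
  GRing.Zmodule.copy (diffop R) {poly {poly R}}.

Section DiffopProduct.
Variable R : comNzRingType.
Implicit Types (a b c : {poly {poly R}}) (s t : {poly R}).

(** Left multiplication by D of a normally ordered operator, by Leibniz's rule [D s = s D + s'].
    Iterating it gives the product [dmul]. *)
Definition Dmul b := map_poly (@deriv R) b + b * 'X.

Definition dmul a b := \sum_(j < size a) a`_j *: iter j Dmul b.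

Lemma DmulD : {morph Dmul : a b / a + b}.
Proof. by move=> a b; rewrite /Dmul raddfD mulrDl addrACA. Qed.

Lemma Dmul0 : Dmul 0 = 0.
Proof. by rewrite /Dmul raddf0 mul0r addr0. Qed.

Lemma DmulZ s b : Dmul (s *: b) = s^`() *: b + s *: Dmul b.
Proof.
rewrite /Dmul scalerDr addrA -scalerAl; congr (_ + _).
by apply/polyP => i; rewrite coefD !coefZ !coef_map coefZ /= derivM.
Qed.

Lemma DmulXn b n : Dmul (b * 'X^n) = Dmul b * 'X^n.
Proof.
rewrite /Dmul mulrDl -mulrA -(commr_polyXn 'X n) mulrA; congr (_ + _).
apply/polyP => i; rewrite coef_map !coefMXn coef_map.
by case: ifP => //; rewrite raddf0.
Qed.

Lemma DmulX b : Dmul (b * 'X) = Dmul b * 'X.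
Proof. exact: (DmulXn b 1). Qed.

Lemma map_deriv1 : map_poly (@deriv R) 1 = 0.
Proof. by rewrite -polyC1 map_polyC /= -[1]polyC1 derivC polyC0. Qed.

Lemma iterDmulD n : {morph iter n Dmul : a b / a + b}.
Proof. by elim: n => // n IH a b /=; rewrite IH DmulD. Qed.

Lemma iterDmul0 n : iter n Dmul 0 = 0.
Proof. by elim: n => //= n ->; rewrite Dmul0. Qed.

Lemma iterDmulXn m b n : iter m Dmul (b * 'X^n) = iter m Dmul b * 'X^n.
Proof. by elim: m => //= m ->; rewrite DmulXn. Qed.

Lemma dmulE n a b : (size a <= n)%N -> dmul a b = \sum_(j < n) a`_j *: iter j Dmul b.
Proof.
move=> le; rewrite /dmul (big_ord_widen n (fun j => a`_j *: iter j Dmul b)) // big_mkcond /=.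
by apply: eq_bigr => i _; case: ltnP => // ?; rewrite nth_default ?scale0r.
Qed.

Lemma dmulDl : left_distributive dmul +%R.
Proof.
move=> a b c; pose n := maxn (size a) (size b).
rewrite (@dmulE n (a + b)) ?size_polyD // (@dmulE n a) ?leq_maxl //.
rewrite (@dmulE n b) ?leq_maxr // -big_split /=.
by apply: eq_bigr => i _; rewrite coefD scalerDl.
Qed.

Lemma dmulDr : right_distributive dmul +%R.
Proof.
move=> a b c; rewrite /dmul -big_split /=.
by apply: eq_bigr => i _; rewrite iterDmulD scalerDr.
Qed.

Lemma dmul0 b : dmul 0 b = 0.
Proof. by rewrite /dmul size_poly0 big_ord0. Qed.

Lemma dmulZl s a b : dmul (s *: a) b = s *: dmul a b.
Proof.
rewrite (@dmulE (size a)) ?size_scale_leq // scaler_sumr.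
by apply: eq_bigr => i _; rewrite coefZ scalerA.
Qed.

Lemma dmulC s b : dmul s%:P b = s *: b.
Proof.
by rewrite (@dmulE 1) ?size_polyC_leq1 // big_ord1 coefC.
Qed.

Lemma dmulX a b : dmul (a * 'X) b = dmul a (Dmul b).
Proof.
rewrite (@dmulE (size a).+1).
  by rewrite big_ord_recl coefMX scale0r add0r; apply: eq_bigr => i _; rewrite coefMX -iterSr.
have [->|an0] := eqVneq a 0; first by rewrite mul0r size_poly0.
by rewrite size_mulX.
Qed.

Lemma dmulXnr a b n : dmul a (b * 'X^n) = dmul a b * 'X^n.
Proof.
rewrite /dmul mulr_suml; apply: eq_bigr => i _.
by rewrite iterDmulXn scalerAl.
Qed.

Lemma Dmul_dmul a b : dmul (Dmul a) b = Dmul (dmul a b).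
Proof.
elim/poly_ind: a b => [|a s IH] b; first by rewrite Dmul0 !dmul0 Dmul0.
rewrite DmulD (dmulDl (Dmul _)) (dmulDl (a * 'X)) DmulD DmulX !dmulX IH; congr (_ + _).
rewrite -[s%:P]mulr1 mul_polyC DmulZ dmulDl !dmulZl !dmulC !scale1r DmulZ.
congr (_ + _ *: _); rewrite /Dmul dmulDl.
by rewrite map_deriv1 dmul0 add0r dmulX -polyC1 dmulC scale1r.
Qed.

Lemma dmulA : associative dmul.
Proof.
move=> a b c; elim/poly_ind: a b => [|a s IH] b; first by rewrite !dmul0.
by rewrite !dmulDl !dmulX -Dmul_dmul IH !dmulC dmulZl.
Qed.

Lemma dmul1 : left_id 1 dmul.
Proof. by move=> b; rewrite -polyC1 dmulC scale1r. Qed.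

Lemma Dmul1 : Dmul 1 = 1 * 'X^1.
Proof. by rewrite /Dmul map_deriv1 add0r. Qed.

Lemma dmulr1 : right_id 1 dmul.
Proof.
elim/poly_ind => [|a s IH]; first by rewrite dmul0.
rewrite dmulDl dmulX dmulC -mul_polyC mulr1; congr (_ + _).
by rewrite Dmul1 dmulXnr IH.
Qed.

End DiffopProduct.

HB.instance Definition _ (R : comNzRingType) :=
  GRing.Zmodule_isNzRing.Build (diffop R) (@dmulA R) (@dmul1 R) (@dmulr1 R)
    (@dmulDl R) (@dmulDr R) (oner_neq0 {poly {poly R}}).

Section DiffopTheory.
Variable R : comNzRingType.
Implicit Types (a b : diffop R) (s t : {poly R}) (r : R).

Definition dC s : diffop R := s%:P.
Definition dX : diffop R := dC 'X.
Definition dD : diffop R := ('X : {poly {poly R}}).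

Lemma dC_mul s a : dC s * a = s *: (a : {poly {poly R}}).
Proof. exact: dmulC. Qed.

Lemma mul_dD a : a * dD = (a : {poly {poly R}}) * 'X.
Proof.
rewrite -[LHS]/(dmul a 'X) -['X in LHS]/('X^1) -['X^1]mul1r dmulXnr.
by rewrite -[dmul a 1]/(a * 1) mulr1.
Qed.

Lemma mul_dDn a n : a * dD ^+ n = (a : {poly {poly R}}) * 'X^n.
Proof.
elim: n a => [|n IH] a; first by rewrite expr0 mulr1 -[RHS]/(_ * 1) mulr1.
by rewrite exprSr mulrA IH mul_dD exprSr mulrA.
Qed.

Lemma dD_mul a : dD * a = a * dD + map_poly (@deriv R) a.
Proof.
rewrite -[LHS]/(dmul 'X a) -['X]mul1r dmulX dmul1 /Dmul addrC.
by rewrite mul_dD.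
Qed.

Lemma dD_dC s : dD * dC s = dC s * dD + dC s^`().
Proof. by rewrite dD_mul /dC map_polyC. Qed.

Lemma diffop_ind (P : diffop R -> Prop) :
  P 0 -> (forall a s, P a -> P (a * dD + dC s)) -> forall a, P a.
Proof.
by move=> P0 PS; elim/poly_ind => // a s IH; have := PS a s IH; rewrite mul_dD.
Qed.

Fact dC_zmod_morphism : zmod_morphism dC.
Proof. exact: raddfB. Qed.

Fact dC_monoid_morphism : monoid_morphism dC.
Proof. by split=> // s t; rewrite dC_mul -mul_polyC -polyCM. Qed.

HB.instance Definition _ :=
  GRing.isZmodMorphism.Build {poly R} (diffop R) dC dC_zmod_morphism.
HB.instance Definition _ :=
  GRing.isMonoidMorphism.Build {poly R} (diffop R) dC dC_monoid_morphism.

Definition dscale r a : diffop R := dC r%:P * a.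

Fact dC_const_comm r a : dC r%:P * a = a * dC r%:P.
Proof.
elim/diffop_ind: a => [|a s IH]; first by rewrite mulr0 mul0r.
rewrite mulrDr mulrDl mulrA IH -rmorphM mulrC rmorphM -!mulrA; congr (_ * _ + _).
by rewrite dD_dC derivC rmorph0 addr0.
Qed.

Fact dscaleA r r' a : dscale r (dscale r' a) = dscale (r * r') a.
Proof. by rewrite /dscale mulrA -rmorphM -polyCM. Qed.

Fact dscale1 : left_id 1 dscale.
Proof. by move=> a; rewrite /dscale polyC1 rmorph1 mul1r. Qed.

Fact dscaleDr : right_distributive dscale +%R.
Proof. by move=> r a b; rewrite /dscale mulrDr. Qed.

Fact dscaleDl a : {morph dscale^~ a : r r' / r + r'}.
Proof. by move=> r r'; rewrite /dscale polyCD rmorphD mulrDl. Qed.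

HB.instance Definition _ := GRing.Zmodule_isLmodule.Build R (diffop R)
  dscaleA dscale1 dscaleDr dscaleDl.

Fact dscaleAl r a b : r *: (a * b) = r *: a * b.
Proof. exact: mulrA. Qed.

HB.instance Definition _ := GRing.Lmodule_isLalgebra.Build R (diffop R) dscaleAl.

Fact dscaleAr r a b : r *: (a * b) = a * (r *: b).
Proof.
by rewrite -[LHS]/(dC _ * _) -[X in _ = _ * X]/(dC _ * _) !mulrA dC_const_comm.
Qed.

HB.instance Definition _ := GRing.Lalgebra_isAlgebra.Build R (diffop R) dscaleAr.

Lemma dscaleE r a : r *: a = dC r%:P * a.
Proof. by []. Qed.

(** The commutator with X is formal differentiation in D, just as [dD_mul] makes the commutator with
    D differentiation in X. *)
Lemma mul_dX a : a * dX = dX * a + (a : {poly {poly R}})^`().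
Proof.
elim/diffop_ind: a => [|a s IH].
  by rewrite mul0r mulr0 deriv0 addr0.
have dDX : dD * dX = dX * dD + 1.
  by rewrite dD_dC derivX rmorph1.
have -> : (a * dD + dC s : {poly {poly R}})^`() = a + (a : {poly {poly R}})^`() * 'X.
  by rewrite mul_dD derivMXaddC.
rewrite mulrDl -mulrA dDX mulrDr mulr1 mulrA IH mulrDl -!rmorphM (mulrC s) rmorphM.
rewrite (mul_dD (a : {poly {poly R}})^`()) mulrDr mulrA.
by rewrite -!addrA; congr (_ + _); rewrite addrCA [RHS]addrC -addrA.
Qed.


Lemma weyl_relation : dD * dX - dX * dD = 1.
Proof. by rewrite dD_dC derivX rmorph1 addrC addKr. Qed.

(** The formal adjoint, which reverses products, fixes X and negates D. *)
Definition anti a : diffop R :=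
  \sum_(j < size (a : {poly {poly R}})) (- dD) ^+ j * dC (a : {poly {poly R}})`_j.

Lemma antiE n a : (size (a : {poly {poly R}}) <= n)%N ->
  anti a = \sum_(j < n) (- dD) ^+ j * dC (a : {poly {poly R}})`_j.
Proof.
move=> le.
rewrite /anti (big_ord_widen n (fun j => (- dD) ^+ j * dC (a : {poly {poly R}})`_j)) //.
rewrite big_mkcond /=; apply: eq_bigr => i _; case: ltnP => // ?.
by rewrite nth_default // rmorph0 mulr0.
Qed.

Fact anti_zmod_morphism : zmod_morphism anti.
Proof.
move=> a b; pose n := maxn (size (a : {poly {poly R}})) (size (b : {poly {poly R}})).
rewrite (@antiE n (a - b)); last first.
  by rewrite (leq_trans (size_polyD _ _)) // size_polyN.
rewrite (@antiE n a) ?leq_maxl // (@antiE n b) ?leq_maxr // -sumrB.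
by apply: eq_bigr => i _; rewrite coefB rmorphB mulrBr.
Qed.

HB.instance Definition _ :=
  GRing.isZmodMorphism.Build (diffop R) (diffop R) anti anti_zmod_morphism.

Lemma anti_dC s : anti (dC s) = dC s.
Proof.
by rewrite (@antiE 1) ?size_polyC_leq1 // big_ord1 coefC expr0 mul1r.
Qed.

Lemma anti_mul_dD a : anti (a * dD) = - dD * anti a.
Proof.
rewrite (@antiE (size (a : {poly {poly R}})).+1); last first.
  rewrite mul_dD; have [->|an0] := eqVneq (a : {poly {poly R}}) 0.
    by rewrite mul0r size_poly0.
  by rewrite size_mulX.
rewrite mul_dD big_ord_recl coefMX rmorph0 mulr0 add0r mulr_sumr.
by apply: eq_bigr => i _; rewrite coefMX exprS -mulrA.
Qed.

Lemma anti_dC_mul s a : anti (dC s * a) = anti a * dC s.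
Proof.
rewrite (@antiE (size (a : {poly {poly R}}))); last first.
  by rewrite dC_mul size_scale_leq.
rewrite mulr_suml; apply: eq_bigr => i _.
by rewrite dC_mul coefZ rmorphM -!rmorphM [s * _]mulrC rmorphM mulrA.
Qed.

Lemma anti_dD_mul a : anti (dD * a) = - (anti a * dD).
Proof.
elim/diffop_ind: a => [|a s IH]; first by rewrite mulr0 !raddf0 mul0r oppr0.
have es : anti (dD * dC s) = - (dC s * dD).
  by rewrite dD_dC raddfD /= anti_mul_dD !anti_dC mulNr dD_dC opprD addrNK.
rewrite mulrDr mulrA raddfD /= anti_mul_dD IH es raddfD /= anti_mul_dD anti_dC.
by rewrite mulrDl !mulNr mulrN opprD !opprK mulrA.
Qed.

Lemma antiM a b : anti (a * b) = anti b * anti a.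
Proof.
elim/diffop_ind: a b => [|a s IH] b; first by rewrite mul0r raddf0 mulr0.
rewrite mulrDl -mulrA raddfD /= IH anti_dD_mul anti_dC_mul raddfD /= anti_mul_dD anti_dC.
by rewrite mulrDr mulNr mulrA mulrN mulNr.
Qed.

Lemma anti1 : anti 1 = 1.
Proof. by rewrite -(rmorph1 dC) anti_dC. Qed.

Lemma antiX a n : anti (a ^+ n) = anti a ^+ n.
Proof. by elim: n => [|n IH]; rewrite ?anti1 // exprS antiM IH exprSr. Qed.

End DiffopTheory.

(** * Homomorphisms out of the Weyl algebra *)

Section Interpretation.
Variables (R : comNzRingType) (B : nzRingType).
Variables (iota : {rmorphism {poly R} -> B}) (y : B).
Hypothesis iota_y : forall s, y * iota s = iota s * y + iota s^`().

(** The proof of the commutation relation is an argument so that the ring morphism structure can be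
    attached to the resulting function. *)
Definition dint_with of (forall s, y * iota s = iota s * y + iota s^`()) :=
  fun a : diffop R =>
  \sum_(j < size (a : {poly {poly R}})) iota (a : {poly {poly R}})`_j * y ^+ j.

Local Notation dint := (dint_with iota_y).

Lemma dintE n (a : diffop R) : (size (a : {poly {poly R}}) <= n)%N ->
  dint a = \sum_(j < n) iota (a : {poly {poly R}})`_j * y ^+ j.
Proof.
move=> le.
rewrite /dint_with (big_ord_widen n (fun j => iota (a : {poly {poly R}})`_j * y ^+ j)) //.
rewrite big_mkcond /=; apply: eq_bigr => i _; case: ltnP => // ?.
by rewrite nth_default // rmorph0 mul0r.
Qed.

Fact dint_zmod_morphism : zmod_morphism dint.
Proof.
move=> a b; pose n := maxn (size (a : {poly {poly R}})) (size (b : {poly {poly R}})).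
rewrite (@dintE n (a - b)); last first.
  by rewrite (leq_trans (size_polyD _ _)) // size_polyN.
rewrite (@dintE n a) ?leq_maxl // (@dintE n b) ?leq_maxr // -sumrB.
by apply: eq_bigr => i _; rewrite coefB rmorphB mulrBl.
Qed.

HB.instance Definition _ :=
  GRing.isZmodMorphism.Build (diffop R) B dint dint_zmod_morphism.

Lemma dint_dC s : dint (dC s) = iota s.
Proof.
by rewrite (@dintE 1) ?size_polyC_leq1 // big_ord1 coefC expr0 mulr1.
Qed.

Lemma dint_mul_dD a : dint (a * dD R) = dint a * y.
Proof.
rewrite (@dintE (size (a : {poly {poly R}})).+1); last first.
  rewrite mul_dD; have [->|an0] := eqVneq (a : {poly {poly R}}) 0.
    by rewrite mul0r size_poly0.
  by rewrite size_mulX.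
rewrite mul_dD big_ord_recl coefMX rmorph0 mul0r add0r mulr_suml.
by apply: eq_bigr => i _; rewrite coefMX exprSr mulrA.
Qed.

Lemma dint_dC_mul s a : dint (dC s * a) = iota s * dint a.
Proof.
rewrite (@dintE (size (a : {poly {poly R}}))); last first.
  by rewrite dC_mul size_scale_leq.
rewrite mulr_sumr; apply: eq_bigr => i _.
by rewrite dC_mul coefZ rmorphM mulrA.
Qed.

Lemma dint_dD_mul a : dint (dD R * a) = y * dint a.
Proof.
elim/diffop_ind: a => [|a s IH]; first by rewrite mulr0 !raddf0 mulr0.
have es : dint (dD R * dC s) = y * iota s.
  by rewrite dD_dC raddfD /= dint_mul_dD !dint_dC iota_y.
rewrite mulrDr mulrA raddfD /= dint_mul_dD IH es raddfD /= dint_mul_dD dint_dC.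
by rewrite mulrDr mulrA.
Qed.

Fact dint_monoid_morphism : monoid_morphism dint.
Proof.
split; first by rewrite -(rmorph1 (@dC R)) dint_dC rmorph1.
move=> a b; elim/diffop_ind: a b => [|a s IH] b; first by rewrite mul0r raddf0 mul0r.
rewrite mulrDl -mulrA raddfD /= IH dint_dD_mul dint_dC_mul raddfD /= dint_mul_dD dint_dC.
by rewrite mulrDl mulrA.
Qed.

HB.instance Definition _ :=
  GRing.isMonoidMorphism.Build (diffop R) B dint dint_monoid_morphism.

Lemma dint_dD : dint (dD R) = y.
Proof. by rewrite -[dD R]mul1r dint_mul_dD rmorph1 mul1r. Qed.

(* A kernel is stable under differentiation in X and in D. *)
Lemma dint_inj (n : nat) (a : diffop R) :
    (forall k (r : R), (0 < k < n)%N -> r *+ k = 0 -> r = 0) ->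
    (forall r, iota r%:P = 0 -> r = 0) ->
    (size (a : {poly {poly R}}) <= n)%N ->
    (forall j, (size ((a : {poly {poly R}})`_j)%R <= n)%N) ->
  dint a = 0 -> a = 0.
Proof.
move=> tf inj.
have poly_tf (s : {poly R}) k : (0 < k < n)%N -> s *+ k = 0 -> s = 0.
  move=> kn sk; apply/polyP => i; rewrite coef0; apply: (tf k) => //.
  by rewrite -coefMn sk coef0.
have kerX (b : diffop R) : dint b = 0 -> dint ((b : {poly {poly R}})^`() : diffop R) = 0.
  move=> b0; have -> : ((b : {poly {poly R}})^`() : diffop R) = b * dX R - dX R * b.
    by rewrite mul_dX addrC addKr.
  by rewrite rmorphB !rmorphM /= b0 mul0r mulr0 subrr.
have kerD (b : diffop R) : dint b = 0 -> dint (map_poly (@deriv R) b : diffop R) = 0.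
  move=> b0; have -> : (map_poly (@deriv R) b : diffop R) = dD R * b - b * dD R.
    by rewrite dD_mul addrC addKr.
  by rewrite rmorphB !rmorphM /= b0 mul0r mulr0 subrr.
have constC (s : {poly R}) : (size s <= n)%N -> dint (dC s) = 0 -> s = 0.
  have [m] := ubnP (size s); elim: m s => // m IH s sm sn s0.
  have ds0 : s^`() = 0.
    have [->|sn0] := eqVneq s 0; first by rewrite deriv0.
    have lt := lt_size_deriv sn0.
    apply: IH; [exact: leq_trans lt sm|exact: leq_trans (ltnW lt) sn|].
    by rewrite -(kerD _ s0) /dC map_polyC.
  have es : s = (s`_0)%:P.
    apply/polyP => -[|i]; rewrite coefC //=.
    have [lt|ge] := ltnP i.+1 n; last by rewrite nth_default // (leq_trans sn).
    by apply: (tf i.+1) => //; rewrite -coef_deriv ds0 coef0.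
  rewrite es (inj s`_0) ?polyC0 // -dint_dC -es //.
have [m] := ubnP (size (a : {poly {poly R}})).
elim: m a => // m IH a sm sn sx a0.
(* The derivative in D has smaller degree and stays in the kernel, so it is 0. As the degree is
   below [n], absence of torsion then makes [a] free of D, and [constC] finishes. *)
have da0 : (a : {poly {poly R}})^`() = 0.
  have [->|an0] := eqVneq (a : {poly {poly R}}) 0; first by rewrite deriv0.
  have lt := lt_size_deriv an0.
  apply: (IH ((a : {poly {poly R}})^`())) => //.
  - exact: leq_trans lt sm.
  - exact: leq_trans (ltnW lt) sn.
  - by move=> j; rewrite coef_deriv -scaler_nat (leq_trans (size_scale_leq _ _)).
  - exact: kerX.
have ea : a = dC (a : {poly {poly R}})`_0.
  apply/polyP => -[|i]; rewrite coefC //=.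
  have [lt|ge] := ltnP i.+1 n; last by rewrite nth_default // (leq_trans sn).
  by apply: (poly_tf _ i.+1) => //; rewrite -coef_deriv da0 coef0.
by rewrite ea (constC (a : {poly {poly R}})`_0) ?rmorph0 // -ea.
Qed.

End Interpretation.

Section Functoriality.
Variables (R R' : comNzRingType) (h : {rmorphism R -> R'}).

Definition dmap (a : diffop R) : diffop R' :=
  map_poly (map_poly h) (a : {poly {poly R}}).

Let iota : {rmorphism {poly R} -> diffop R'} := @dC R' \o map_poly h.

Fact dmap_deriv s : dD R' * iota s = iota s * dD R' + iota s^`().
Proof. by rewrite /iota /= dD_dC deriv_map. Qed.

Lemma dmap_dint a : dmap a = dint_with dmap_deriv a.
Proof.
elim/diffop_ind: a => [|a s IH]; first by rewrite /dmap !raddf0.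
rewrite raddfD /= dint_mul_dD dint_dC -IH !mul_dD /dmap.
by rewrite rmorphD rmorphM /= map_polyX map_polyC.
Qed.

Fact dmap_zmod_morphism : zmod_morphism dmap.
Proof. exact: raddfB. Qed.

Fact dmap_monoid_morphism : monoid_morphism dmap.
Proof. by split=> [|a b]; rewrite !dmap_dint ?rmorph1 ?rmorphM. Qed.

HB.instance Definition _ :=
  GRing.isZmodMorphism.Build (diffop R) (diffop R') dmap dmap_zmod_morphism.
HB.instance Definition _ :=
  GRing.isMonoidMorphism.Build (diffop R) (diffop R') dmap dmap_monoid_morphism.

Lemma dmap_dC s : dmap (dC s) = dC (map_poly h s).
Proof. by rewrite dmap_dint dint_dC. Qed.

Lemma dmap_dD : dmap (dD R) = dD R'.
Proof. by rewrite dmap_dint dint_dD. Qed.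

Lemma dmap_dX : dmap (dX R) = dX R'.
Proof. by rewrite dmap_dC map_polyX. Qed.

Lemma anti_dmap a : anti (dmap a) = dmap (anti a).
Proof.
elim/diffop_ind: a => [|a s IH]; first by rewrite !raddf0.
rewrite rmorphD rmorphM /= dmap_dD dmap_dC ![anti (_ + _)]raddfD /=.
by rewrite !anti_mul_dD !anti_dC rmorphD rmorphM rmorphN /= dmap_dD dmap_dC IH.
Qed.

End Functoriality.

Definition dcoef (R : comNzRingType) (a : diffop R) (i j : nat) : R :=
  ((a : {poly {poly R}})`_j)`_i.

Lemma dcoefP (R : comNzRingType) (a b : diffop R) :
  (forall i j, dcoef a i j = dcoef b i j) <-> a = b.
Proof.
split=> [eq|-> //]; apply/polyP => j; apply/polyP => i; exact: eq.
Qed.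

Lemma dcoef_dmap (R R' : comNzRingType) (h : {rmorphism R -> R'}) a i j :
  dcoef (dmap h a) i j = h (dcoef a i j).
Proof. by rewrite /dcoef /dmap !coef_map. Qed.

Lemma dcoefB (R : comNzRingType) (a b : diffop R) i j :
  dcoef (a - b) i j = dcoef a i j - dcoef b i j.
Proof. by rewrite /dcoef !coefB. Qed.

Lemma dcoefZ (R : comNzRingType) r (a : diffop R) i j :
  dcoef (r *: a) i j = r * dcoef a i j.
Proof. by rewrite dscaleE dC_mul /dcoef coefZ coefCM. Qed.

Lemma dcoef_sum (R : comNzRingType) (I : Type) (s : seq I) (P : pred I) (F : I -> diffop R) i j :
  dcoef (\sum_(k <- s | P k) F k) i j = \sum_(k <- s | P k) dcoef (F k) i j.
Proof.
apply: (big_morph (fun a => dcoef a i j)) => [a b|]; first by rewrite /dcoef !coefD.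
by rewrite /dcoef !coef0.
Qed.

Section Commutation.
Variable R : comNzRingType.
Implicit Types (a b : diffop R) (s : {poly R}).

Lemma diffop_central b : b * dX R = dX R * b -> b * dD R = dD R * b ->
  forall a, b * a = a * b.
Proof.
move=> bX bD; elim/diffop_ind => [|a s IH]; first by rewrite mulr0 mul0r.
rewrite mulrDr mulrA IH -mulrA bD mulrDl mulrA; congr (_ + _).
elim/poly_ind: s => [|s r IHs]; first by rewrite rmorph0 mulr0 mul0r.
rewrite rmorphD rmorphM mulrDr mulrA IHs -mulrA bX mulrDl mulrA; congr (_ + _).
by rewrite dC_const_comm.
Qed.

Lemma commute_dX b : b * dX R = dX R * b -> forall i j, dcoef b i j.+1 *+ j.+1 = 0.
Proof.
rewrite mul_dX => /(canRL (addKr _)); rewrite addNr => b0 i j.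
by rewrite /dcoef -coefMn -coef_deriv b0 !coef0.
Qed.

Lemma commute_dD b : b * dD R = dD R * b -> forall i j, dcoef b i.+1 j *+ i.+1 = 0.
Proof.
rewrite dD_mul => /esym/(canRL (addKr _)); rewrite addNr => b0 i j.
by rewrite /dcoef -coef_deriv -coef_map b0 !coef0.
Qed.

End Commutation.

Lemma commutator_expr (B : nzRingType) (P Q : B) n :
  Q * P - P * Q = 1 -> Q ^+ n * P = P * Q ^+ n + Q ^+ n.-1 *+ n.
Proof.
move=> QP; have eQP : Q * P = P * Q + 1 by rewrite -QP addrC subrK.
elim: n => [|n IH]; first by rewrite expr0 mul1r mulr1 addr0.
rewrite exprS -mulrA IH mulrDr mulrA eQP mulrDl mul1r -mulrA -exprS mulrnAr -addrA.
congr (_ + _); rewrite mulrS; congr (_ + _).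
by case: n {IH} => // n; rewrite -exprS.
Qed.

(** * Prime characteristic: the centre *)

Lemma linear_dependence (F : fieldType) (I J : finType) (A : I -> J -> F) :
  (#|J| < #|I|)%N ->
  exists c : I -> F, (exists i, c i != 0) /\ forall j, \sum_i c i * A i j = 0.
Proof.
move=> ltJI; pose M := \matrix_(i < #|I|, j < #|J|) A (enum_val i) (enum_val j).
have : kermx M != 0.
  by rewrite -mxrank_eq0 mxrank_ker subn_eq0 -ltnNge (leq_ltn_trans (rank_leq_col _)).
case/rowV0Pn => v /sub_kermxP vM vn0; exists (fun i => v 0 (enum_rank i)); split.
  by case/rV0Pn: vn0 => i vi; exists (enum_val i); rewrite enum_valK.
move=> j; have := congr1 (fun u : 'rV_#|J| => u 0 (enum_rank j)) vM.
rewrite !mxE => vj; rewrite -[RHS]vj (reindex (@enum_rank I)) /=.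
  by apply: eq_bigr => i _; rewrite mxE !enum_rankK.
exact: onW_bij (enum_rank_bij I).
Qed.

Section Expansion.
Variables (R : comNzRingType) (p : nat).
Hypothesis p_gt0 : (0 < p)%N.

Definition expand (z : {poly {poly R}}) : {poly {poly R}} :=
  map_poly (comp_poly 'X^p) z \Po 'X^p.

Fact expand_zmod_morphism : zmod_morphism expand.
Proof. by move=> z w; rewrite /expand !rmorphB. Qed.

Fact expand_monoid_morphism : monoid_morphism expand.
Proof. by split=> [|z w]; rewrite /expand ?rmorph1 ?rmorphM. Qed.

HB.instance Definition _ :=
  GRing.isZmodMorphism.Build {poly {poly R}} {poly {poly R}} expand expand_zmod_morphism.
HB.instance Definition _ :=
  GRing.isMonoidMorphism.Build {poly {poly R}} {poly {poly R}} expand expand_monoid_morphism.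

Lemma expandC s : expand s%:P = (s \Po 'X^p)%:P.
Proof. by rewrite /expand map_polyC comp_polyC. Qed.

Lemma expandX : expand 'X = 'X^p.
Proof. by rewrite /expand map_polyX comp_polyX. Qed.

Lemma coef_expand z i j :
  (expand z)`_j`_i = if (p %| j)%N && (p %| i)%N then z`_(j %/ p)`_(i %/ p) else 0.
Proof.
rewrite /expand coef_comp_poly_Xn //; case: ifP => _ /=; last by rewrite coef0.
by rewrite coef_map /= coef_comp_poly_Xn.
Qed.

Lemma expand_inj z : expand z = 0 -> z = 0.
Proof.
move=> z0; apply/polyP => j; apply/polyP => i; rewrite !coef0.
have := coef_expand z (p * i) (p * j).
by rewrite z0 !coef0 !dvdn_mulr //= !mulKn.
Qed.

Lemma expand_poly M (E : nat -> nat -> R) :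
  expand (\poly_(j < M) \poly_(i < M) E i j)
  = \sum_(j < M) \sum_(i < M) (E i j *: 'X^(p * i))%:P * 'X^(p * j).
Proof.
rewrite poly_def rmorph_sum; apply: eq_bigr => j _.
rewrite -mul_polyC rmorphM rmorphXn /= expandC expandX -exprM -mulr_suml; congr (_ * _).
rewrite poly_def rmorph_sum rmorph_sum; apply: eq_bigr => i _ /=.
by rewrite comp_polyZ comp_Xn_poly -exprM.
Qed.

End Expansion.

Lemma bipoly_bound (R : comNzRingType) (I : finType) (v : I -> {poly {poly R}}) :
  exists c, forall k i j, (c <= i)%N || (c <= j)%N -> (v k)`_j`_i = 0.
Proof.
pose c := \max_k maxn (size (v k)) (\max_(j < size (v k)) size ((v k)`_j)%R).
exists c => k i j.
have ck : (maxn (size (v k)) (\max_(j < size (v k)) size ((v k)`_j)%R) <= c)%N.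
  exact: (leq_bigmax k).
have [jl|jg] := ltnP j (size (v k)); last by rewrite (nth_default 0 jg) coef0.
case/orP => [ci|cj]; last by move: jl; rewrite ltnNge (leq_trans _ cj) // (leq_trans _ ck) // leq_maxl.
rewrite nth_default // (leq_trans _ ci) // (leq_trans _ ck) // (leq_trans _ (leq_maxr _ _)) //.
exact: (leq_bigmax (Ordinal jl)).
Qed.

(* Polynomials in x, y of degree at most N form a space of dimension about  *)
(* N^2, of which p^2 + 1 linearly independent families indexed by the       *)
(* x^(pi) y^(pj) would occupy (1 + p^-2) N^2 dimensions.                    *)
Lemma expand_dependence (F : fieldType) (p : nat) (I : finType) (v : I -> {poly {poly F}}) :
  (0 < p)%N -> (p ^ 2 < #|I|)%N ->
  exists z : I -> {poly {poly F}}, (exists k, z k != 0) /\ \sum_k expand p (z k) * v k = 0.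
Proof.
move=> p_gt0 ltI; have [c vc] := bipoly_bound v.
(* There are at least (p^2 + 1) M^2 unknowns and B^2 = (p M + c)^2 equations. This [M] gives M^2 > 2
   p c M + c^2, so the unknowns prevail. *)
pose M := (2 * p * c + c + 1)%N; pose B := (p * M + c)%N.
pose A (x : I * 'I_M * 'I_M) (y : 'I_B * 'I_B) : F :=
  (('X^(p * x.1.2))%:P * 'X^(p * x.2) * v x.1.1)`_y.2`_y.1.
have coefA k i j s t : (('X^(p * i))%:P * 'X^(p * j) * v k)`_t`_s =
    if (t < p * j)%N || (s < p * i)%N then 0 else (v k)`_(t - p * j)`_(s - p * i).
  rewrite -mulrA coefCM coefXnM; case: ifP => _; first by rewrite mulr0 coef0.
  by rewrite coefXnM.
have [|C [[[[k0 i0] j0] C0] CA]] := linear_dependence A.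
  rewrite !card_prod !card_ord /B /M; nia.
pose E k i j := if insub i is Some i' then if insub j is Some j' then C (k, i', j') else 0 else 0 : F.
have EC k (i j : 'I_M) : E k i j = C (k, i, j) by rewrite /E !valK.
exists (fun k => \poly_(j < M) \poly_(i < M) E k i j); split.
  exists k0; apply: contraNneq C0 => /(congr1 (fun q : {poly {poly F}} => q`_j0`_i0)).
  by rewrite !coef0 coef_poly ltn_ord coef_poly ltn_ord EC => ->.
have -> : \sum_k expand p (\poly_(j < M) \poly_(i < M) E k i j) * v k
    = \sum_(x : I * 'I_M * 'I_M) (C x)%:P%:P * (('X^(p * x.1.2))%:P * 'X^(p * x.2) * v x.1.1).
  pose f k i j := (C (k, i, j))%:P%:P * (('X^(p * i))%:P * 'X^(p * j) * v k).
  transitivity (\sum_k \sum_i \sum_j f k i j).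
    apply: eq_bigr => k _; rewrite expand_poly mulr_suml [RHS]exchange_big /=; apply: eq_bigr => j _.
    rewrite mulr_suml; apply: eq_bigr => i _.
    by rewrite EC -mul_polyC polyCM /f !mulrA.
  by rewrite pair_bigA /= pair_bigA; apply: eq_bigr => -[[k i] j] _.
apply/polyP => t; apply/polyP => s; rewrite !coef0 coef_sum coef_sum.
have [/andP[tB sB]|out] := boolP ((t < B)%N && (s < B)%N).
  rewrite -[RHS](CA (Ordinal sB, Ordinal tB)).
  by apply: eq_bigr => x _; rewrite coefCM coefCM.
rewrite big1 // => -[[k i] j] _; rewrite coefCM coefCM coefA /=.
case: ifP; first by rewrite mulr0.
move=> /negbT; rewrite negb_or -!leqNgt => /andP[tj si].
rewrite vc ?mulr0 //; have := ltn_ord i; have := ltn_ord j.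
move: out; rewrite negb_and -!leqNgt /B => /orP[] *; apply/orP; [right|left]; nia.
Qed.

Section PrimeCharacteristic.
Variables (F : fieldType) (p : nat).
Hypothesis pcharF : p \in [pchar F].
Local Notation W := (diffop F).
Local Notation Z := {poly {poly F}}.
Implicit Types a b w : W.

Let p_gt0 : (0 < p)%N := prime_gt0 (pcharf_prime pcharF).

Lemma diffop_mulrn_pchar a : a *+ p = 0.
Proof. by rewrite -scaler_nat (pcharf0 pcharF) scale0r. Qed.

Lemma dDp_central a : dD F ^+ p * a = a * dD F ^+ p.
Proof.
apply: diffop_central; last by rewrite -exprS -exprSr.
by rewrite (commutator_expr p (weyl_relation F)) diffop_mulrn_pchar addr0.
Qed.

Lemma dXp_central a : dX F ^+ p * a = a * dX F ^+ p.
Proof.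
apply: diffop_central; first by rewrite -exprS -exprSr.
have QP : dX F * - dD F - - dD F * dX F = 1.
  by rewrite mulrN mulNr opprK addrC weyl_relation.
have := commutator_expr p QP; rewrite diffop_mulrn_pchar addr0 mulrN mulNr.
exact: oppr_inj.
Qed.

(** Left multiplication by a polynomial in X^p and D^p is the commutative product of normal forms.
    Linear algebra over commutative polynomials, and cancellation there, thus transfer to [W]. *)
Lemma expand_dmul (z : Z) a : (expand p z : W) * a = expand p z * (a : {poly {poly F}}) :> Z.
Proof.
elim/poly_ind: z a => [|z s IH] a; first by rewrite !rmorph0 !mul0r.
have eX : (expand p z * 'X^p : W) * a = ((expand p z : W) * a : Z) * 'X^p :> Z.
  by rewrite -(mul_dDn (expand p z : W)) -mulrA dDp_central mulrA mul_dDn.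
rewrite rmorphD rmorphM /= expandX expandC.
rewrite -[LHS]/(((expand p z * 'X^p : W) + dC _) * a) mulrDl dC_mul eX IH.
by rewrite [RHS]mulrDl -mul_polyC; congr (_ + _); exact: mulrAC.
Qed.

Definition centre_embed (z : Z) : W := expand p z.

Fact centre_embed_zmod_morphism : zmod_morphism centre_embed.
Proof. exact: raddfB. Qed.

Fact centre_embed_monoid_morphism : monoid_morphism centre_embed.
Proof.
by split=> [|z w]; rewrite /centre_embed ?rmorph1 // expand_dmul rmorphM.
Qed.

HB.instance Definition _ :=
  GRing.isZmodMorphism.Build Z W centre_embed centre_embed_zmod_morphism.
HB.instance Definition _ :=
  GRing.isMonoidMorphism.Build Z W centre_embed centre_embed_monoid_morphism.

Lemma centre_embed_comm (z : Z) a : a * centre_embed z = centre_embed z * a.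
Proof.
elim/poly_ind: z => [|z s IH]; first by rewrite rmorph0 mulr0 mul0r.
have eX : centre_embed 'X = dD F ^+ p.
  by rewrite /centre_embed expandX -[RHS]mul1r mul_dDn mul1r.
rewrite rmorphD rmorphM mulrDr mulrDl /= eX mulrA IH -!mulrA dDp_central; congr (_ + _).
rewrite /centre_embed expandC -/(dC _).
elim/poly_ind: s => [|s r IHs]; first by rewrite comp_poly0 rmorph0 mulr0 mul0r.
rewrite comp_polyD comp_polyM comp_polyX comp_polyC rmorphD rmorphM rmorphXn.
by rewrite mulrDr mulrDl mulrA IHs -!mulrA dXp_central dC_const_comm.
Qed.

Section CanonicalPair.
Variables P Q : W.
Hypothesis QP : Q * P - P * Q = 1.

Lemma pair_horner_comm : commr_rmorph centre_embed P.
Proof. by move=> z; rewrite /GRing.comm centre_embed_comm. Qed.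

(** With [pair_horner_deriv], this interprets the Weyl algebra over the commutative ring [Z] in [W],
    sending X to [P] and D to [Q]. *)
Definition pair_horner : {poly Z} -> W := horner_morph pair_horner_comm.

Fact pair_horner_zmod_morphism : zmod_morphism pair_horner.
Proof. exact: raddfB. Qed.

Fact pair_horner_monoid_morphism : monoid_morphism pair_horner.
Proof. by split; [exact: rmorph1|exact: rmorphM]. Qed.

HB.instance Definition _ :=
  GRing.isZmodMorphism.Build {poly Z} W pair_horner pair_horner_zmod_morphism.
HB.instance Definition _ :=
  GRing.isMonoidMorphism.Build {poly Z} W pair_horner pair_horner_monoid_morphism.

Lemma pair_hornerC z : pair_horner z%:P = centre_embed z.
Proof. exact: horner_morphC. Qed.

Lemma pair_hornerX : pair_horner 'X = P.
Proof. exact: horner_morphX. Qed.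

Lemma pair_horner_deriv s : Q * pair_horner s = pair_horner s * Q + pair_horner s^`().
Proof.
elim/poly_ind: s => [|s z IH].
  by rewrite deriv0 !rmorph0 mulr0 mul0r addr0.
have eQP : Q * P = P * Q + 1 by rewrite -QP addrC subrK.
rewrite derivMXaddC !rmorphD !rmorphM /= pair_hornerC pair_hornerX.
rewrite mulrDr mulrA IH !mulrDl -centre_embed_comm -!mulrA eQP mulrDr mulr1.
by rewrite [RHS]addrAC !addrA.
Qed.

(** A dependence is an operator over [Z], of degrees below p, in the kernel of this interpretation.
    [dint_inj] applies since the integers strictly between 0 and p are nonzero in [F]. *)
Lemma pair_independent (z : nat -> nat -> Z) :
  \sum_(t < p) \sum_(s < p) centre_embed (z s t) * P ^+ s * Q ^+ t = 0 ->
  forall s t, (s < p)%N -> (t < p)%N -> z s t = 0.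
Proof.
pose a : diffop Z := \poly_(t < p) \poly_(s < p) z s t.
have -> : \sum_(t < p) \sum_(s < p) centre_embed (z s t) * P ^+ s * Q ^+ t
    = dint_with pair_horner_deriv a.
  rewrite (@dintE _ _ _ _ _ p) ?size_poly //; apply: eq_bigr => t _.
  rewrite -mulr_suml coef_poly ltn_ord poly_def rmorph_sum; congr (_ * _).
  apply: eq_bigr => s _.
  by rewrite -mul_polyC rmorphM rmorphXn /= pair_hornerC pair_hornerX.
move=> a0 s t sp tp; suff a00 : a = 0.
  have := congr1 (fun q : {poly {poly Z}} => q`_t`_s) a00.
  by rewrite !coef0 coef_poly tp coef_poly sp.
apply: (dint_inj _ _ _ _ a0).
- move=> k r /andP[k0 kp] rk; apply/eqP; apply: contraT => rn0.
  have : (k%:R : F) != 0.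
    by rewrite -(dvdn_pcharf pcharF); apply/negP => /(dvdn_leq k0); rewrite leqNgt kp.
  move=> kn0; have /eqP : r * (k%:R)%:P%:P = 0 by rewrite !polyC_natr mulr_natr.
  by rewrite mulf_eq0 (negPf rn0) !polyC_eq0 (negPf kn0).
- by move=> r; rewrite /= pair_hornerC => /(expand_inj p_gt0).
- exact: size_poly.
- by move=> j; rewrite coef_poly; case: ifP; rewrite ?size_poly0 ?size_poly.
Qed.

Lemma pair_power_comm : Q * P ^+ p = P ^+ p * Q.
Proof.
have PQ : P * - Q - - Q * P = 1 by rewrite mulrN mulNr opprK addrC.
have := commutator_expr p PQ; rewrite diffop_mulrn_pchar addr0 mulrN mulNr.
by move/oppr_inj.
Qed.

(* W has rank p^2 over its centre, and the p^2 products P^s Q^t with s, t < p *)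
(* are linearly independent over it.                                        *)
Theorem pair_power_central w : P ^+ p * w = w * P ^+ p.
Proof.
pose u := P ^+ p.
pose v (k : 'I_1 + 'I_p * 'I_p) : Z :=
  if k is inr st then P ^+ st.1 * Q ^+ st.2 else w.
have [|z [[k0 zk0] zv]] := expand_dependence v p_gt0.
  by rewrite card_sum card_prod !card_ord -mulnn.
have cv (st : 'I_p * 'I_p) : u * (P ^+ st.1 * Q ^+ st.2) = P ^+ st.1 * Q ^+ st.2 * u.
  have uQ : GRing.comm u (Q ^+ st.2) by apply/commrX/esym/pair_power_comm.
  by rewrite -mulrA -uQ !mulrA -!exprD addnC.
have eqN : centre_embed (z (inl ord0)) * w +
    \sum_(st : 'I_p * 'I_p) centre_embed (z (inr st)) * (P ^+ st.1 * Q ^+ st.2) = 0.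
  rewrite -[RHS]zv big_sumType big_ord1 /=; congr (_ + _); first exact: expand_dmul.
  by apply: eq_bigr => st _; exact: expand_dmul.
(* The coefficient of [w] cannot vanish, for the relation would then contradict
   [pair_independent]. *)
have [zN0|zNn0] := eqVneq (z (inl ord0)) 0.
  case/eqP: zk0; case: k0 => [i|[s0 t0]]; first by rewrite ord1.
  pose zz (s t : nat) : Z :=
    if insub s is Some s' then if insub t is Some t' then z (inr (s', t')) else 0 else 0.
  have zzE (s t : 'I_p) : zz s t = z (inr (s, t)) by rewrite /zz !valK.
  rewrite -zzE; apply: pair_independent => //.
  rewrite exchange_big pair_bigA /=; move: eqN; rewrite zN0 rmorph0 mul0r add0r => eqN.
  by rewrite -[RHS]eqN; apply: eq_bigr => -[s t] _; rewrite zzE mulrA.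
(* [u] commutes with all other terms of the relation, hence with a nonzero central multiple of [w],
   and the central factor cancels. *)
have : expand p (z (inl ord0)) * ((u * w - w * u : W) : Z) = 0.
  rewrite -expand_dmul -/(centre_embed _).
  set E := centre_embed _ in eqN *.
  have -> : E * (u * w - w * u) = u * (E * w) - E * w * u.
    by rewrite mulrBr !mulrA [u * E]centre_embed_comm.
  move/eqP: eqN; rewrite addr_eq0 => /eqP ->.
  rewrite mulrN mulNr opprK mulr_sumr mulr_suml addrC -sumrB.
  rewrite big1 // => st _.
  by rewrite [u * (_ * _)]mulrA centre_embed_comm -!mulrA cv -!mulrA subrr.
move/eqP; rewrite mulf_eq0 => /orP[/eqP/(expand_inj p_gt0)/eqP|]; first by rewrite (negPf zNn0).
by rewrite subr_eq0 => /eqP.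
Qed.

End CanonicalPair.
End PrimeCharacteristic.

(** * Supports and leading coefficients *)

Section Support.
Variable R : comNzRingType.
Implicit Types a b : diffop R.

Definition dsupp (m n : nat) a :=
  forall i j, dcoef a i j != 0 -> (i <= m)%N && (j <= n)%N.

Lemma dsuppP m n a :
  dsupp m n a <-> forall i j, (m < i)%N || (n < j)%N -> dcoef a i j = 0.
Proof.
split=> H i j.
  by apply: contraTeq => /H; rewrite negb_or -!leqNgt.
by apply: contraR; rewrite negb_and -!ltnNge => /H->; rewrite eqxx.
Qed.

Lemma dsuppD m n a b : dsupp m n a -> dsupp m n b -> dsupp m n (a + b).
Proof.
move=> /dsuppP sa /dsuppP sb; apply/dsuppP => i j ij.
by rewrite /dcoef !coefD -/(dcoef a i j) -/(dcoef b i j) sa ?sb ?addr0.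
Qed.

Lemma dsupp_Dmul m n a : dsupp m n a -> dsupp m n.+1 (Dmul a).
Proof.
move=> /dsuppP s; apply: dsuppD; apply/dsuppP => i j ij.
  rewrite /dcoef coef_map coef_deriv -/(dcoef a i.+1 j) s ?mul0rn //.
  by case/orP: ij => ij; rewrite ?(ltnW ij) ?orbT // ltnW.
rewrite /dcoef coefMX; case: j ij => [|j] ij; first by rewrite coef0.
by rewrite -/(dcoef a i j) s.
Qed.

(** Normal ordering only lowers exponents. *)
Lemma dsuppM m n m' n' a b : dsupp m n a -> dsupp m' n' b -> dsupp (m + m') (n + n') (a * b).
Proof.
move=> /dsuppP sa sb.
have sit j : dsupp m' (n' + j) (iter j (@Dmul R) b).
  by elim: j => [|j IH]; rewrite ?addn0 ?addnS //=; apply: dsupp_Dmul.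
have eq : a * b = \sum_(j < size (a : {poly {poly R}})) (a : {poly {poly R}})`_j *: iter j (@Dmul R) b.
  by [].
rewrite eq; elim/big_ind: _ => [|c d|j _]; [by move=> i j; rewrite /dcoef !coef0 eqxx|exact: dsuppD|].
have [jn|jn] := leqP j n; last first.
  have -> : (a : {poly {poly R}})`_j = 0.
    by apply/polyP => i; rewrite coef0 -/(dcoef a i j) sa // jn orbT.
  by rewrite scale0r => i k; rewrite /dcoef !coef0 eqxx.
have sj := sit j; move/dsuppP in sj.
apply/dsuppP => i k ik; rewrite /dcoef coefZ coefM big1 // => l _.
have [lm|lm] := leqP l m; last by rewrite -/(dcoef a l j) sa ?lm ?mul0r.
rewrite -[X in _ * X]/(dcoef _ _ _) sj ?mulr0 //.
have := ltn_ord l; case/orP: ik => H lt; apply/orP; [left|right]; lia.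
Qed.

Lemma dsuppX m n a k : dsupp m n a -> dsupp (m * k) (n * k) (a ^+ k).
Proof.
move=> sa; elim: k => [|k IH]; last by rewrite exprS !mulnS; apply: dsuppM.
rewrite !muln0 expr0; apply/dsuppP => i j.
rewrite -[1]/((1 : {poly {poly R}}) : diffop R) /dcoef coef1.
by case: j => [|j]; rewrite ?coef0 // orbF coef1; case: i.
Qed.

Lemma dcoef_monomial i j s t :
  dcoef (dX R ^+ i * dD R ^+ j) s t = ((s == i) && (t == j))%:R.
Proof.
rewrite mul_dDn -rmorphXn /dcoef coefMXn; case: ltnP => jt.
  by rewrite coef0 (ltn_eqF jt) andbF.
rewrite coefC subn_eq0 (eqn_leq t j) jt andbT.
by case: leqP => _; rewrite ?coef0 ?andbF // coefXn andbT.
Qed.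

End Support.

Section LeadingCoefficient.
Variable R : idomainType.
Implicit Types a b : diffop R.
Local Notation sz a := (size (a : {poly {poly R}})).
Local Notation lc a := (lead_coef (a : {poly {poly R}})).

Lemma iterDmul_lead (b : {poly {poly R}}) j : b != 0 ->
  size (iter j (@Dmul R) b) = (size b + j)%N /\ lead_coef (iter j (@Dmul R) b) = lead_coef b.
Proof.
move=> bn0; elim: j => [|j [IHs IHl]]; first by rewrite addn0.
set c := iter j _ _ in IHs IHl *; rewrite /= -/c /Dmul.
have cn0 : c != 0 by rewrite -size_poly_gt0 IHs addn_gt0 size_poly_gt0 bn0.
have lt : (size (map_poly (@deriv R) c) < size (c * 'X)%R)%N.
  by rewrite size_mulX // ltnS size_poly.
by rewrite addrC size_polyDl // lead_coefDl // size_mulX // IHs addnS lead_coefMX IHl.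
Qed.

(** Moving D past coefficients produces only terms of lower degree in D. *)
Lemma diffopM_lead a b : a != 0 -> b != 0 ->
  sz (a * b) = (sz a + sz b).-1 /\ lc (a * b) = lc a * lc b.
Proof.
move=> an0 bn0.
have eq : a * b = \sum_(j < sz a) (a : {poly {poly R}})`_j *: iter j (@Dmul R) b :> {poly {poly R}} by [].
have : (0 < sz a)%N by rewrite size_poly_gt0.
case es : (sz a) eq => [//|n] eq _; rewrite eq big_ord_recr /=.
have [sn ln] := iterDmul_lead n bn0.
have an : (a : {poly {poly R}})`_n != 0.
  by have := an0; rewrite -lead_coef_eq0 lead_coefE es.
have lt : (size (\sum_(j < n) (a : {poly {poly R}})`_j *: iter j (@Dmul R) b)%R
    < size ((a : {poly {poly R}})`_n *: iter n (@Dmul R) b)%R)%N.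
  rewrite size_scale // sn; apply: leq_ltn_trans (size_sum _ _ _) _.
  have : (0 < sz b)%N by rewrite size_poly_gt0.
  case: (sz b) (fun j => (iterDmul_lead j bn0).1) => // k sj _.
  rewrite addSn ltnS; apply/bigmax_leqP => j _.
  apply: leq_trans (size_scale_leq _ _) _; rewrite sj addSn -addnS leq_add2l.
  exact: ltn_ord.
rewrite addrC size_polyDl // lead_coefDl // size_scale // lead_coefZ sn ln addnC.
by split=> //; rewrite [lc a]lead_coefE es.
Qed.

Lemma diffopX_lead a k : a != 0 ->
  sz (a ^+ k) = ((sz a).-1 * k).+1 /\ lc (a ^+ k) = lc a ^+ k.
Proof.
move=> an0; elim: k => [|k [IHs IHl]].
  by rewrite muln0 !expr0; split; [exact: size_poly1|exact: lead_coef1].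
have akn0 : a ^+ k != 0 by rewrite -[_ == 0]size_poly_eq0 IHs.
have [s l] := diffopM_lead an0 akn0.
rewrite !exprS s l IHs IHl; split=> //.
have : (0 < sz a)%N by rewrite size_poly_gt0.
by case: (sz a) => // m _; rewrite addSn addnS /= mulnS.
Qed.

End LeadingCoefficient.

(** * Commutators modulo the square of a prime *)

Section CommutatorsModSquare.
Variables (B : nzRingType) (p : nat).
Hypotheses (pr_p : prime p) (sq0 : (p ^ 2)%:R = 0 :> B).

(** The normal ordering formula. For [s > m] the subtraction is truncated, but the falling factorial
    is 0. *)
Lemma commutator_expr2 (P Q : B) n m : Q * P - P * Q = 1 ->
  Q ^+ n * P ^+ m =
  \sum_(s < n.+1) (P ^+ (m - s) * Q ^+ (n - s)) *+ ('C(n, s) * m ^_ s).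
Proof.
move=> QP; have PQ : P * - Q - - Q * P = 1 by rewrite mulrN mulNr opprK addrC.
have QPk k : Q * P ^+ k = P ^+ k * Q + P ^+ k.-1 *+ k.
  have := commutator_expr k PQ; rewrite mulrN mulNr => e.
  by rewrite -[P ^+ k * Q]opprK e opprD opprK addrNK.
elim: n => [|n IH]; first by rewrite big_ord1 expr0 mul1r subn0 mulr1 bin0 ffactn0 mulr1n.
pose T s := P ^+ (m - s) * Q ^+ (n.+1 - s).
have -> : Q ^+ n.+1 * P ^+ m =
    \sum_(s < n.+1) (T s *+ ('C(n, s) * m ^_ s) + T s.+1 *+ ('C(n, s) * m ^_ s.+1)).
  rewrite exprS -mulrA IH mulr_sumr; apply: eq_bigr => s _.
  rewrite mulrnAr mulrA QPk mulrDl mulrnDl -mulrA -exprS -subSn -1?ltnS ?ltn_ord //.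
  congr (_ + _); rewrite /T subSS subnS mulrnAl -mulrnA ffactnSr; congr (_ *+ _).
  by rewrite [RHS]mulnA mulnC.
rewrite big_split /= [RHS]big_ord_recl [X in X + _ = _]big_ord_recl -[LHS]addrA; congr (_ + _).
  by rewrite !bin0.
rewrite [X in _ + X = _]big_ord_recr [RHS]big_ord_recr /= addrA -big_split /=; congr (_ + _).
  by apply: eq_bigr => s _; rewrite -mulrnDr -mulnDl -binS.
by rewrite !binn.
Qed.

Lemma mulrn_sq (x : B) k : x *+ (p ^ 2 * k) = 0.
Proof. by rewrite mulrnA -[_ *+ (p ^ 2)]mulr_natr sq0 mulr0 mul0rn. Qed.

(** For 0 < s < p both the binomial and the falling factorial are divisible by p, so only the terms
    s = 0 and s = p survive modulo p^2. *)
Lemma commutator_primepow (P Q : B) : Q * P - P * Q = 1 ->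
  Q ^+ p * P ^+ p - P ^+ p * Q ^+ p = (p`!)%:R.
Proof.
move=> QP; rewrite (commutator_expr2 p p QP) big_ord_recl /= bin0 ffactn0 !subn0 mulr1n.
have p_gt0 := prime_gt0 pr_p.
rewrite [X in X - _]addrC addrK.
case: p pr_p p_gt0 mulrn_sq => // q pr_q _ sq.
rewrite big_ord_recr /= big1 => [|s _].
  by rewrite add0r subnn !expr0 mulr1 binn mul1n ffactnn.
have : (q.+1 %| 'C(q.+1, s.+1))%N by rewrite prime_dvd_bin //= ltnS ltn_ord.
rewrite /bump add1n ffactnS => /dvdnP[c ->].
have -> : (c * q.+1 * (q.+1 * q ^_ s) = q.+1 ^ 2 * (c * q ^_ s))%N by rewrite -mulnn; ring.
exact: sq.
Qed.

(** The cross terms are p times commutators with [b] or [c], which vanish by hypothesis, and the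
    remaining term carries p^2. *)
Lemma commutator_perturb (b b' c c' : B) :
    (forall w, (b * w - w * b) *+ p = 0) -> (forall w, (c * w - w * c) *+ p = 0) ->
  (b + b' *+ p) * (c + c' *+ p) - (c + c' *+ p) * (b + b' *+ p) = b * c - c * b.
Proof.
move=> cb cc.
have UV (x y : B) : (x *+ p) * (y *+ p) = 0.
  by rewrite mulrnAl mulrnAr -mulrnA -mulr_natr mulnn sq0 mulr0.
rewrite !mulrDl !mulrDr !UV !addr0 !mulrnAl !mulrnAr.
have -> : (c * b') *+ p = (b' * c) *+ p by apply: subr0_eq; rewrite -mulrnBl cc.
have -> : (b * c') *+ p = (c' * b) *+ p by apply: subr0_eq; rewrite -mulrnBl cb.
set u := (c' * b) *+ p; set v := (b' * c) *+ p.
by rewrite -(addrA _ u v) -(addrA _ v u) (addrC v u) opprD addrACA subrr addr0.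
Qed.

Variables (E H : B) (k : nat).
Hypotheses (HE : H * E = E * H + k%:R) (k2 : k%:R * k%:R = 0 :> B).

Lemma small_commutator_expr i : H * E ^+ i = E ^+ i * H + E ^+ i.-1 *+ (k * i).
Proof.
elim: i => [|i IH]; first by rewrite expr0 mulr1 mul1r muln0 addr0.
rewrite exprSr mulrA IH mulrDl -mulrA HE mulrDr mulrA mulr_natr -addrA mulnSr mulrnDr.
congr (_ + _); rewrite addrC; congr (_ + _).
by case: i {IH} => [|i]; rewrite ?muln0 // mulrnAl -exprSr.
Qed.

(** Each of the [i j] transpositions contributes [k], and second-order corrections carry
    [k ^ 2 = 0]. It is applied to E = X^p, H = D^p and k = p!. *)
Lemma small_commutator_expr2 i j :
  H ^+ j * E ^+ i = E ^+ i * H ^+ j + (E ^+ i.-1 * H ^+ j.-1) *+ (k * (i * j)).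
Proof.
elim: j => [|j IH]; first by rewrite expr0 mulr1 mul1r !muln0 addr0.
rewrite exprS -mulrA IH mulrDr mulrA small_commutator_expr mulrDl -mulrA -exprS.
rewrite -addrA; congr (_ + _).
have -> : H * ((E ^+ i.-1 * H ^+ j.-1) *+ (k * (i * j))) = (E ^+ i.-1 * H ^+ j) *+ (k * (i * j)).
  case: j {IH} => [|j]; first by rewrite !muln0 mulr0.
  rewrite mulrnAr mulrA small_commutator_expr mulrDl -mulrA -exprS mulrnDl.
  rewrite mulrnAl -mulrnA.
  have -> : (k * i.-1 * (k * (i * j.+1)) = (k * k) * (i.-1 * (i * j.+1)))%N by ring.
  have kk0 (x : B) m : x *+ (k * k * m) = 0.
    by rewrite mulrnA -[_ *+ (k * k)]mulr_natr natrM k2 mulr0 mul0rn.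
  by rewrite kk0 addr0.
by rewrite mulrnAl -mulrnDr; congr (_ *+ _); ring.
Qed.

Lemma small_commutator_monomial i j i' j' :
  (E ^+ i * H ^+ j) * (E ^+ i' * H ^+ j') =
  E ^+ (i + i') * H ^+ (j + j') + (E ^+ (i + i').-1 * H ^+ (j + j').-1) *+ (k * (i' * j)).
Proof.
rewrite mulrA -[_ * E ^+ i']mulrA small_commutator_expr2 mulrDr mulrDl; congr (_ + _).
  by rewrite mulrA -exprD -mulrA -exprD.
case: i' => [|i']; first by rewrite !muln0 !mulr0n mulr0 mul0r.
case: j => [|j]; first by rewrite !muln0 !mulr0n mulr0 mul0r.
by rewrite mulrnAr mulrnAl mulrA -exprD -mulrA -exprD addnS.
Qed.

End CommutatorsModSquare.

(** * The Jacobian of p-th powers, through lifts modulo p^2 *)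

Section ReductionModSquare.
Variables (p : nat) (R2 : comNzRingType) (F : fieldType) (rho : {rmorphism R2 -> F}).
Hypotheses (pcharF : p \in [pchar F]) (sq0 : (p ^ 2)%:R = 0 :> R2).
Hypothesis rho_ker : forall r, rho r = 0 -> exists r', r = r' *+ p.
Hypothesis rho_torsion : forall r, r *+ p = 0 -> rho r = 0.

Let pr_p : prime p := pcharf_prime pcharF.
Let p_gt0 : (0 < p)%N := prime_gt0 pr_p.

Lemma diffop_natr (R : comNzRingType) n : n%:R = n%:R *: 1 :> diffop R.
Proof. by rewrite scaler_nat. Qed.

Lemma diffop_sq0 : (p ^ 2)%:R = 0 :> diffop R2.
Proof. by rewrite diffop_natr sq0 scale0r. Qed.

Lemma dmap_ker (a : diffop R2) : dmap rho a = 0 -> exists a', a = a' *+ p.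
Proof.
move=> a0; have ex r : exists r', rho r = 0 -> r = r' *+ p.
  by have [/rho_ker[r' ->]|n0] := eqVneq (rho r) 0; [exists r'|exists 0 => r0; rewrite r0 eqxx in n0].
have [f fE] := choice ex.
exists (\poly_(j < size (a : {poly {poly R2}}))
  \poly_(i < size (a : {poly {poly R2}})`_j) f (dcoef a i j)).
apply/polyP => j; apply/polyP => i.
have -> (b : diffop R2) : (b *+ p : {poly {poly R2}}) = (b : {poly {poly R2}}) *+ p.
  by elim: (p) => // n; rewrite !mulrSr => ->.
rewrite !coefMn coef_poly; case: ltnP => [_|ge]; last by rewrite (nth_default 0 ge) !coef0 mul0rn.
rewrite coef_poly; case: ltnP => [_|ge]; last by rewrite nth_default ?mul0rn.
by apply: fE; rewrite -dcoef_dmap a0 /dcoef !coef0.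
Qed.

Lemma ker_mulrn (a : diffop R2) : dmap rho a = 0 -> a *+ p = 0.
Proof.
by case/dmap_ker => b ->; rewrite -mulrnA -mulr_natr mulnn diffop_sq0 mulr0.
Qed.

(** Over [F] this is an element of the centre; over [R2] it is a lift of one and need not be
    central. *)
Definition centre_poly (R : comNzRingType) (d : nat) (c : nat -> nat -> R) : diffop R :=
  \sum_(i < d.+1) \sum_(j < d.+1) c i j *: ((dX R ^+ p) ^+ i * (dD R ^+ p) ^+ j).

Lemma dcoef_centre_monomial (R : comNzRingType) i j s t :
  dcoef ((dX R ^+ p) ^+ i * (dD R ^+ p) ^+ j) s t = ((s == p * i)%N && (t == p * j)%N)%:R.
Proof. by rewrite -!exprM dcoef_monomial. Qed.

Lemma dcoef_centre_poly (R : comNzRingType) d (c : nat -> nat -> R) i j :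
  dcoef (centre_poly d c) (p * i) (p * j) = if (i <= d)%N && (j <= d)%N then c i j else 0.
Proof.
have zero (i' j' : nat) : (i' != i) || (j' != j) ->
    dcoef (c i' j' *: ((dX R ^+ p) ^+ i' * (dD R ^+ p) ^+ j')) (p * i) (p * j) = 0.
  move=> ij; rewrite dcoefZ dcoef_centre_monomial !eqn_pmul2l //.
  by move: ij; rewrite -negb_and (eq_sym i) (eq_sym j) => /negPf->; rewrite mulr0.
rewrite dcoef_sum; case: ifP => [/andP[id jd]|/negbT].
  rewrite (bigD1 (Ordinal (id : (i < d.+1)%N))) //= dcoef_sum.
  rewrite (bigD1 (Ordinal (jd : (j < d.+1)%N))) //= dcoefZ dcoef_centre_monomial !eqxx mulr1.
  rewrite big1 => [|j' nj]; last by apply: zero; apply/orP; right.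
  rewrite addr0 big1 ?addr0 // => i' ni; rewrite dcoef_sum big1 // => j' _.
  by apply: zero; apply/orP; left.
rewrite negb_and -!ltnNge => out; rewrite big1 // => i' _; rewrite dcoef_sum big1 // => j' _.
apply: zero; have := ltn_ord i'; have := ltn_ord j'; lia.
Qed.

Lemma dcoef_centre_poly0 (R : comNzRingType) d (c : nat -> nat -> R) s t :
  ~~ ((p %| s)%N && (p %| t)%N) -> dcoef (centre_poly d c) s t = 0.
Proof.
move=> nd; rewrite dcoef_sum big1 // => i _; rewrite dcoef_sum big1 // => j _.
rewrite dcoefZ dcoef_centre_monomial; case: andP => [[/eqP es /eqP et]|]; last by rewrite mulr0.
by move: nd; rewrite es et !dvdn_mulr.
Qed.

(** Commuting with D and X multiplies the coefficient at X^s D^t by s and by t to give 0; hence the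
    centre is F[X^p, D^p]. *)
Lemma centralizes_dcoef0 (v : diffop F) s t : (forall w, v * w = w * v) ->
  ~~ ((p %| s)%N && (p %| t)%N) -> dcoef v s t = 0.
Proof.
move=> cv; have np k : ~~ (p %| k.+1)%N -> k.+1%:R != 0 :> F.
  by rewrite (dvdn_pcharf pcharF).
rewrite negb_and => /orP[].
  case: s => [|s]; first by rewrite dvdn0.
  move=> /np n0; have /eqP := commute_dD (cv _) s t.
  by rewrite -mulr_natr mulf_eq0 (negPf n0) orbF => /eqP.
case: t => [|t]; first by rewrite dvdn0.
move=> /np n0; have /eqP := commute_dX (cv _) s t.
by rewrite -mulr_natr mulf_eq0 (negPf n0) orbF => /eqP.
Qed.

Lemma central_centre_poly d (v : diffop F) :
    (forall w, v * w = w * v) -> dsupp (p * d) (p * d) v ->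
  v = centre_poly d (fun i j => dcoef v (p * i) (p * j)).
Proof.
move=> cv /dsuppP sv; apply/dcoefP => s t.
have [|nd] := boolP ((p %| s)%N && (p %| t)%N); last first.
  by rewrite dcoef_centre_poly0 // centralizes_dcoef0.
case/andP => /dvdnP[i ->] /dvdnP[j ->]; rewrite ![(_ * p)%N]mulnC dcoef_centre_poly.
case: ifP => // /negbT; rewrite negb_and -!ltnNge => out.
by rewrite sv // !ltn_pmul2l.
Qed.

Lemma dmap_centre_poly d (c : nat -> nat -> R2) :
  dmap rho (centre_poly d c) = centre_poly d (fun i j => rho (c i j)).
Proof.
rewrite rmorph_sum; apply: eq_bigr => i _; rewrite rmorph_sum; apply: eq_bigr => j _.
by rewrite !dscaleE !rmorphM !rmorphXn /= dmap_dC map_polyC dmap_dX dmap_dD.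
Qed.

Lemma centre_poly_lift d (v : diffop R2) :
    (forall w, dmap rho v * w = w * dmap rho v) -> dsupp (p * d) (p * d) (dmap rho v) ->
  dmap rho (v - centre_poly d (fun i j => dcoef v (p * i) (p * j))) = 0.
Proof.
move=> cv sv; rewrite rmorphB /= dmap_centre_poly; apply/eqP; rewrite subr_eq0; apply/eqP.
rewrite [LHS](central_centre_poly cv sv).
by apply: eq_bigr => i _; apply: eq_bigr => j _; rewrite dcoef_dmap.
Qed.

(** D^p is skew for odd p, which turns skewness of Q^p into oddness of psi in its second
    variable. *)
Lemma anti_centre_poly d (c : nat -> nat -> F) : odd p ->
  anti (centre_poly d c) = centre_poly d (fun i j => (-1) ^+ j * c i j).
Proof.
move=> p_odd; rewrite raddf_sum; apply: eq_bigr => i _; rewrite raddf_sum; apply: eq_bigr => j _ /=.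
have anti_dD : anti (dD F) = - dD F by rewrite -[dD F in LHS]mul1r anti_mul_dD anti1 mulr1.
rewrite dscaleE anti_dC_mul -dC_const_comm -dscaleE antiM !antiX anti_dD anti_dC.
have -> : ((- dD F) ^+ p) ^+ j = (-1) ^+ j * (dD F ^+ p) ^+ j.
  by rewrite [(- dD F) ^+ p]exprNn -signr_odd p_odd expr1 mulN1r exprNn.
rewrite -mulrA.
have -> : (dD F ^+ p) ^+ j * (dX F ^+ p) ^+ i = (dX F ^+ p) ^+ i * (dD F ^+ p) ^+ j.
  by apply/commrX/commr_sym/commrX/commr_sym; exact: dDp_central.
rewrite -(signr_odd (diffop F) j) -(signr_odd F j).
by case: (odd j); rewrite ?expr0 ?expr1 ?mul1r // !mulN1r scalerN scaleNr.
Qed.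

Lemma dXp_dDp_commutator : dD R2 ^+ p * dX R2 ^+ p = dX R2 ^+ p * dD R2 ^+ p + (p`!)%:R.
Proof. by rewrite -(commutator_primepow pr_p diffop_sq0 (weyl_relation R2)) addrC subrK. Qed.

Lemma fact_sq0 : (p`!)%:R * (p`!)%:R = 0 :> diffop R2.
Proof.
rewrite -natrM; have [q eq] : exists q, p`! = (p * q)%N.
  by exists p.-1`!; rewrite -(prednK p_gt0) factS.
have -> : (p`! * p`! = p ^ 2 * q ^ 2)%N by rewrite eq -expnMn.
by rewrite natrM diffop_sq0 mul0r.
Qed.

(** Since (p!)^2 = 0, the commutator is exactly of first order in [D^p, X^p] = p!: it is p! times
    the Poisson bracket. *)
Lemma centre_poly_commutator d (a b : nat -> nat -> R2) m n :
  dcoef (centre_poly d b * centre_poly d a - centre_poly d a * centre_poly d b) (p * m) (p * n)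
  = (p`!)%:R * jacobian_coef d a b m n.
Proof.
pose mon i j := (dX R2 ^+ p) ^+ i * (dD R2 ^+ p) ^+ j.
have commr (c : nat -> nat -> R2) x : x * centre_poly d c - centre_poly d c * x =
    \sum_(i < d.+1) \sum_(j < d.+1) c i j *: (x * mon i j - mon i j * x).
  rewrite mulr_sumr mulr_suml -sumrB; apply: eq_bigr => i _.
  rewrite mulr_sumr mulr_suml -sumrB; apply: eq_bigr => j _.
  by rewrite -scalerAr -scalerAl -scalerBr.
have comml (c : nat -> nat -> R2) x : centre_poly d c * x - x * centre_poly d c =
    \sum_(i < d.+1) \sum_(j < d.+1) c i j *: (mon i j * x - x * mon i j).
  rewrite -opprB commr -sumrN; apply: eq_bigr => i _; rewrite -sumrN; apply: eq_bigr => j _.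
  by rewrite -scalerN opprB.
rewrite comml dcoef_sum mulr_sumr; apply: eq_bigr => i _.
rewrite dcoef_sum mulr_sumr; apply: eq_bigr => j _.
rewrite commr dcoefZ dcoef_sum !mulr_sumr; apply: eq_bigr => k _.
rewrite dcoef_sum !mulr_sumr; apply: eq_bigr => l _.
rewrite /mon !(small_commutator_monomial dXp_dDp_commutator fact_sq0).
rewrite (addnC k i) (addnC l j) opprD addrACA subrr add0r -!scaler_nat -scalerBl !dcoefZ.
rewrite dcoef_centre_monomial !eqn_pmul2l // !natrM -mulrBr.
case: ifP => [/andP[/eqP -> /eqP ->]|/negbT out].
  by rewrite !eqxx /jacobian_term !natrM mulr1; ring.
rewrite mulr0; case: andP => [[/eqP em /eqP en]|_]; last by rewrite !mulr0.
(* Here a truncated predecessor makes the exponents match although [i + k = 0] or [j + l = 0]; the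
   integer factor vanishes then. *)
have -> : k%:R * j%:R - i%:R * l%:R = 0 :> R2.
  apply/eqP; rewrite -!natrM subr_eq0; apply/eqP; congr (_%:R).
  have [e|e] : (i + k = 0)%N \/ (j + l = 0)%N by move: out; rewrite em en; lia.
    have [-> ->] : nat_of_ord k = 0%N /\ nat_of_ord i = 0%N by lia.
    by rewrite !mul0n.
  have [-> ->] : nat_of_ord j = 0%N /\ nat_of_ord l = 0%N by lia.
  by rewrite !muln0.
by rewrite mulr0 mul0r !mulr0.
Qed.

Section CanonicalPair.
Variables (P Q : diffop R2) (d : nat).
Hypothesis QP : Q * P - P * Q = 1.
Let P1 := dmap rho P.
Let Q1 := dmap rho Q.
Hypotheses (supp_P : dsupp d d P1) (supp_Q : dsupp d d Q1).

Let QP1 : Q1 * P1 - P1 * Q1 = 1.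
Proof. by rewrite -!rmorphM -rmorphB QP rmorph1. Qed.

Let rho_nat n : rho n%:R = n%:R.
Proof. exact: rmorph_nat. Qed.

Let PQ1 : P1 * - Q1 - - Q1 * P1 = 1.
Proof. by rewrite mulrN mulNr opprK addrC. Qed.

Lemma pair_power_central2 w : Q1 ^+ p * w = w * Q1 ^+ p.
Proof.
have := pair_power_central pcharF (P := Q1) (Q := - P1).
by rewrite mulrN mulNr opprK addrC; apply.
Qed.

(** The p-th powers differ from the lifts [A], [B] by multiples of p that do not affect the
    commutator. So p! equals p! times the Jacobian; [rho_torsion] cancels p, and (p-1)! is
    invertible modulo p. *)
Lemma jacobian_pair_power m n :
  jacobian_coef d (fun i j => dcoef (P1 ^+ p) (p * i) (p * j))
    (fun i j => dcoef (Q1 ^+ p) (p * i) (p * j)) m n = ((m == 0%N) && (n == 0%N))%:R.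
Proof.
pose a i j := dcoef (P ^+ p) (p * i) (p * j).
pose b i j := dcoef (Q ^+ p) (p * i) (p * j).
have ea i j : dcoef (P1 ^+ p) (p * i) (p * j) = rho (a i j).
  by rewrite -(rmorphXn (dmap rho)) dcoef_dmap.
have eb i j : dcoef (Q1 ^+ p) (p * i) (p * j) = rho (b i j).
  by rewrite -(rmorphXn (dmap rho)) dcoef_dmap.
have -> : jacobian_coef d (fun i j => dcoef (P1 ^+ p) (p * i) (p * j))
    (fun i j => dcoef (Q1 ^+ p) (p * i) (p * j)) m n = rho (jacobian_coef d a b m n).
  rewrite rmorph_sum; apply: eq_bigr => i _; rewrite rmorph_sum; apply: eq_bigr => j _.
  rewrite rmorph_sum; apply: eq_bigr => k _; rewrite rmorph_sum; apply: eq_bigr => l _.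
  case: ifP => _; last by rewrite rmorph0.
  by rewrite /jacobian_term 2!rmorphM rmorphB !rho_nat ea eb.
pose A := centre_poly d a; pose B := centre_poly d b.
have PA : dmap rho (P ^+ p - A) = 0.
  apply: centre_poly_lift => [w|]; rewrite rmorphXn; last by rewrite [(p * d)%N]mulnC; apply: dsuppX.
  exact: (pair_power_central pcharF QP1).
have QB : dmap rho (Q ^+ p - B) = 0.
  apply: centre_poly_lift => [w|]; rewrite rmorphXn; last by rewrite [(p * d)%N]mulnC; apply: dsuppX.
  exact: pair_power_central2.
have [U eU] := dmap_ker PA; have [V eV] := dmap_ker QB.
have cB w : (B * w - w * B) *+ p = 0.
  apply: ker_mulrn; rewrite rmorphB !rmorphM /=.
  have -> : dmap rho B = Q1 ^+ p.
    by move/eqP: QB; rewrite rmorphB subr_eq0 rmorphXn => /eqP.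
  by rewrite pair_power_central2 subrr.
have cA w : (A * w - w * A) *+ p = 0.
  apply: ker_mulrn; rewrite rmorphB !rmorphM /=.
  have -> : dmap rho A = P1 ^+ p.
    by move/eqP: PA; rewrite rmorphB subr_eq0 rmorphXn => /eqP.
  by rewrite (pair_power_central pcharF QP1) subrr.
have eP : P ^+ p = A + U *+ p by rewrite -eU addrC subrK.
have eQ : Q ^+ p = B + V *+ p by rewrite -eV addrC subrK.
have comm : B * A - A * B = (p`!)%:R.
  rewrite -(commutator_primepow pr_p diffop_sq0 QP) eP eQ.
  exact/esym/(commutator_perturb diffop_sq0 V U cB cA).
have := centre_poly_commutator d a b m n.
rewrite -/A -/B comm.
have -> : dcoef ((p`!)%:R : diffop R2) (p * m) (p * n) = (p`!)%:R * ((m == 0%N) && (n == 0%N))%:R.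
  rewrite diffop_natr dcoefZ; congr (_ * _).
  have := dcoef_monomial R2 0 0 (p * m) (p * n); rewrite !expr0 mulr1 => ->.
  by rewrite !muln_eq0 !(gtn_eqF p_gt0).
move=> /esym/eqP; rewrite -subr_eq0 -mulrBr => /eqP.
rewrite -(prednK p_gt0) factS (prednK p_gt0) natrM -mulrA => e.
have /rho_torsion : (p.-1`!%:R * (jacobian_coef d a b m n - ((m == 0%N) && (n == 0%N))%:R)) *+ p = 0.
  by rewrite -mulr_natl.
rewrite rmorphM rmorphB /= !rho_nat => /eqP; rewrite mulf_eq0 subr_eq0 => /orP[|/eqP//].
rewrite -(dvdn_pcharf pcharF) => dv; exfalso.
have ndv k : (k < p)%N -> ~~ (p %| k`!)%N.
  elim: k => [|k IH] kp; first by rewrite fact0 dvdn1 neq_ltn prime_gt1 ?orbT.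
  by rewrite factS Euclid_dvdM // negb_or IH 1?ltnW // andbT gtnNdvd.
by move: dv; apply/negP/ndv; rewrite ltn_predL.
Qed.

Lemma skew_partner_reduction : anti Q = - Q -> odd p -> (d ^ 2 < p)%N ->
  forall i j, dcoef Q1 i j != 0 -> i = 0%N /\ j = 1%N.
Proof.
move=> skQ p_odd dp.
have skQ1 : anti Q1 = - Q1 by rewrite anti_dmap skQ rmorphN.
pose v := Q1 ^+ p; pose b i j := dcoef v (p * i) (p * j).
have sv : dsupp (p * d) (p * d) v by rewrite mulnC; apply: dsuppX.
have F2 : 2%:R != 0 :> F.
  rewrite -(dvdn_pcharf pcharF) dvdn_prime2 //; apply: contraTneq p_odd => ->; done.
have ev : v = centre_poly d b := central_centre_poly pair_power_central2 sv.
have bij i j : b i j != 0 -> i = 0%N /\ j = 1%N.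
  have bound (w : diffop F) i' j' : dsupp (p * d) (p * d) w -> dcoef w (p * i') (p * j') != 0 -> (i' <= d)%N && (j' <= d)%N.
    by move=> sw /sw; rewrite !leq_pmul2l.
  apply: (skew_jacobian_pair _ _ _ _ jacobian_pair_power) => [n /andP[n0 nd]|i' j'|i' j'|i' j' ej].
  - rewrite -(dvdn_pcharf pcharF) gtnNdvd //; exact: leq_ltn_trans dp.
  - by apply: bound; rewrite mulnC; apply: dsuppX.
  - by apply: bound.
  (* Oddness: for even [j'], comparing coefficients in [anti v = - v] gives [2 b = 0]. *)
  apply/eqP; apply: contraT => bn0; have /andP[i'd j'd] := bound _ _ _ sv bn0.
  have := congr1 (fun w => dcoef w (p * i') (p * j')) (congr1 (@anti F) ev).
  rewrite anti_centre_poly // dcoef_centre_poly i'd j'd /v antiX skQ1 [(- Q1) ^+ p]exprNn.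
  rewrite -(signr_odd (diffop F) p) p_odd -(signr_odd F j') (negPf ej) expr0 expr1 mul1r mulN1r.
  rewrite -[- _]sub0r dcoefB {1}/dcoef !coef0 sub0r => /eqP; rewrite -subr_eq0 -opprD oppr_eq0.
  by rewrite -mulr2n -mulr_natr mulf_eq0 (negPf F2) orbF (negPf bn0).
have vij s t : dcoef v s t != 0 -> s = 0%N /\ t = p.
  move=> vst; have := vst; rewrite ev => nz.
  have [|nd] := boolP ((p %| s)%N && (p %| t)%N); last first.
    by rewrite dcoef_centre_poly0 ?eqxx in nz.
  case/andP => /dvdnP[i es] /dvdnP[j et]; move: vst; rewrite es et ![(_ * p)%N]mulnC.
  by move/bij => [-> ->]; rewrite muln0 muln1.
have Q1n0 : Q1 != 0.
  apply/eqP => Q10; have := QP1; rewrite Q10 mul0r mulr0 subrr => /eqP.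
  by rewrite eq_sym oner_eq0.
have [sz lc] := diffopX_lead p Q1n0.
have vn0 : v != 0 by rewrite -[_ == 0]size_poly_eq0 sz.
have lcn0 : lead_coef (v : {poly {poly F}}) != 0 by rewrite lead_coef_eq0.
(* [v] has degree p in D and a constant leading coefficient. Taking p-th powers multiplies degrees
   by p, so [Q1] has degree 1 in D and a constant leading coefficient. *)
have [sQ lQ] : size (Q1 : {poly {poly F}}) = 2%N /\ (size (lead_coef (Q1 : {poly {poly F}})) <= 1)%N.
  have top : size (v : {poly {poly F}}) = p.+1.
    have /vij[_ <-] : dcoef v (size (lead_coef (v : {poly {poly F}}))).-1 (size (v : {poly {poly F}})).-1 != 0.
      by rewrite /dcoef -lead_coefE -lead_coefE lead_coef_eq0.
    by rewrite prednK // size_poly_gt0.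
  split.
    have : (0 < size (Q1 : {poly {poly F}}))%N by rewrite size_poly_gt0.
    by move: sz; rewrite -/v top => -[]; case: (size _) => // m /=; nia.
  have lc1 : size (lead_coef (v : {poly {poly F}})) = 1%N.
    have /vij[e _] : dcoef v (size (lead_coef (v : {poly {poly F}}))).-1 (size (v : {poly {poly F}})).-1 != 0.
      by rewrite /dcoef -lead_coefE -lead_coefE lead_coef_eq0.
    by rewrite -(prednK (_ : 0 < size (lead_coef (v : {poly {poly F}})))%N) ?size_poly_gt0 // e.
  have := size_exp (lead_coef (Q1 : {poly {poly F}})) p; rewrite -lc -/v lc1 /=.
  by case: (size _) => // m /=; nia.
pose q0 := (Q1 : {poly {poly F}})`_0; pose q1 := (Q1 : {poly {poly F}})`_1.
have eQ1 : Q1 = dC q1 * dD F + dC q0.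
  rewrite mul_dD; apply/polyP => k; rewrite coefD coefMX !coefC.
  case: k => [|[|k]] /=; rewrite ?add0r ?addr0 //.
  by rewrite nth_default // sQ.
have lq1 : q1 = lead_coef (Q1 : {poly {poly F}}) by rewrite lead_coefE sQ.
have [r er] : exists r, q1 = r%:P by exists q1`_0; apply: size1_polyC; rewrite lq1.
(* The adjoint of [r D + q0] is [q0 - r D], so skewness leaves [2 q0 = 0]. *)
have q00 : q0 = 0.
  have e1 : anti Q1 = dC q0 - dC q1 * dD F.
    by rewrite eQ1 raddfD /= anti_mul_dD !anti_dC er mulNr dD_dC derivC rmorph0 addr0 addrC.
  have : dC (q0 *+ 2) = 0.
    have e2 : dC q0 = - Q1 + dC q1 * dD F by rewrite -skQ1 e1 subrK.
    by rewrite rmorphMn mulr2n [X in X + _]e2 -addrA -eQ1 addNr.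
  move=> /polyC_inj/eqP; rewrite -mulr_natr mulf_eq0 -polyC_natr polyC_eq0 (negPf F2) orbF.
  by move/eqP.
move=> i j; rewrite eQ1 q00 rmorph0 addr0 mul_dD /dcoef coefMX coefC er.
case: j => [|[|j]] /=; [by rewrite coef0 eqxx| |by rewrite coef0 eqxx].
by rewrite coefC; case: i => [|i] //=; rewrite eqxx.
Qed.

End CanonicalPair.
End ReductionModSquare.

(** * Characteristic zero *)

Section ResidueModuloSquare.
Variables (p : nat) (pr_p : prime p).
Local Notation R2 := 'Z_(p ^ 2).
Let q_gt1 : (1 < p ^ 2)%N := sqr_prime_gt1 pr_p.

Definition residue_of of prime p := fun r : R2 => (r : nat)%:R : 'F_p.
Local Notation residue := (residue_of pr_p).

Lemma residue_natr n : (n %% (Zp_trunc (p ^ 2)).+2)%:R = n%:R :> 'F_p.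
Proof.
have -> : (n %% (Zp_trunc (p ^ 2)).+2 = n %% p ^ 2)%N by rewrite Zp_cast.
rewrite [in RHS](divn_eq n (p ^ 2)) natrD natrM natrX.
by rewrite (pcharf0 (pchar_Fp pr_p)) expr0n mulr0 add0r.
Qed.

Fact residue_semi_additive : nmod_morphism residue.
Proof. by split=> // r s; rewrite /residue_of residue_natr natrD. Qed.

Fact residue_monoid_morphism : monoid_morphism residue.
Proof.
split=> [|r s]; last by rewrite /residue_of residue_natr natrM.
by rewrite /residue_of residue_natr.
Qed.

HB.instance Definition _ := GRing.isNmodMorphism.Build R2 'F_p residue residue_semi_additive.
HB.instance Definition _ := GRing.isMonoidMorphism.Build R2 'F_p residue residue_monoid_morphism.

Lemma residue_eq0 (r : R2) : residue r = 0 -> (p %| r)%N.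
Proof. by move/eqP; rewrite -(dvdn_pcharf (pchar_Fp pr_p)). Qed.

Lemma residue_ker (r : R2) : residue r = 0 -> exists r', r = r' *+ p.
Proof.
by case/residue_eq0/dvdnP => k e; exists k%:R; rewrite -mulrnA -e natr_Zp.
Qed.

Lemma residue_torsion (r : R2) : r *+ p = 0 -> residue r = 0.
Proof.
rewrite -[r in r *+ p]natr_Zp -mulrnA => /(congr1 (fun s : R2 => (s : nat))).
rewrite val_Zp_nat // => /eqP dv.
apply/eqP; rewrite -(dvdn_pcharf (pchar_Fp pr_p)) -(dvdn_pmul2r (prime_gt0 pr_p)).
exact: dv.
Qed.

End ResidueModuloSquare.

Lemma dmap_lift (R R' : comNzRingType) (e : {rmorphism R -> R'}) (a : diffop R') :
  (forall i j, exists s, e s = dcoef a i j) -> exists b, dmap e b = a.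
Proof.
move=> lift; have [f fE] := choice (fun ij : nat * nat => lift ij.1 ij.2).
exists (\poly_(j < size (a : {poly {poly R'}}))
  \poly_(i < size (a : {poly {poly R'}})`_j) f (i, j)).
apply/dcoefP => i j; rewrite dcoef_dmap /dcoef coef_poly.
case: ltnP => [_|ge]; last by rewrite (nth_default 0 ge) !coef0 rmorph0.
rewrite coef_poly; case: ltnP => [_|ge]; last by rewrite (nth_default 0 ge) rmorph0.
exact: fE.
Qed.

Lemma dmap_specializes (R R1 R2 : comNzRingType) (e : {rmorphism R -> R1})
    (g : {rmorphism R -> R2}) (a : diffop R) :
  specializes e g -> dmap e a = 0 -> dmap g a = 0.
Proof.
move=> sp a0; apply/dcoefP => i j; rewrite dcoef_dmap [RHS]/dcoef !coef0.
by apply: sp; rewrite -dcoef_dmap a0 /dcoef !coef0.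
Qed.

(** A coefficient of [Q] off the monomial D would stay a unit under a suitable specialization modulo
    p^2, against [skew_partner_reduction]. *)
Theorem skew_partner (K : fieldType) (P Q : diffop K) : [pchar K] =i pred0 ->
  Q * P - P * Q = 1 -> anti Q = - Q -> exists2 c, c != 0 & Q = c *: dD K.
Proof.
move=> charK QP skQ.
pose coefs (a : diffop K) := flatten (map (@polyseq K) (polyseq (a : {poly {poly K}}))).
have coefs0 a i j : dcoef a i j \in 0 :: coefs a.
  rewrite inE /dcoef; have [jl|jl] := ltnP j (size (a : {poly {poly K}})); last first.
    by rewrite (nth_default 0 jl) coef0 eqxx.
  have [il|il] := ltnP i (size ((a : {poly {poly K}})`_j)); last by rewrite (nth_default 0 il) eqxx.
  apply/orP; right; apply/flattenP; exists (polyseq (a : {poly {poly K}})`_j); last exact: mem_nth.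
  by apply/map_f/mem_nth.
have [S [e [imS spec]]] := Zp2_specialization (0 :: coefs P ++ coefs Q) charK.
have [P' eP] : exists P', dmap e P' = P.
  apply: dmap_lift => i j; apply: imS; have := coefs0 P i j.
  by rewrite !inE mem_cat => /orP[->|->]; rewrite ?orbT.
have [Q' eQ] : exists Q', dmap e Q' = Q.
  apply: dmap_lift => i j; apply: imS; have := coefs0 Q i j.
  by rewrite !inE mem_cat => /orP[->|->]; rewrite ?orbT.
(* The degrees are bounded on the lifts over [S], hence before p is chosen and for every
   specialization. *)
have [d0 bound] := bipoly_bound (fun b : bool => if b then P' : {poly {poly S}} else Q').
have suppS (R : comNzRingType) (h : {rmorphism S -> R}) (b : bool) :
    dsupp d0 d0 (dmap h (if b then P' else Q')).
  apply/dsuppP => i j ij; rewrite dcoef_dmap /dcoef.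
  have out : (d0 <= i)%N || (d0 <= j)%N by case/orP: ij => /ltnW->; rewrite ?orbT.
  by have := bound b i j out; case: b => /= ->; rewrite rmorph0.
have bad i j : dcoef Q i j != 0 -> i = 0%N /\ j = 1%N.
  move=> nz; have et : e (dcoef Q' i j) != 0 by rewrite -dcoef_dmap eQ.
  (* The bound provides [d0 ^ 2 < p] for the Jacobian argument and excludes p = 2. *)
  have [p [pr_p Bp [g sp ug]]] := spec _ (d0 ^ 2 + 2)%N et.
  pose rho : {rmorphism 'Z_(p ^ 2) -> 'F_p} := residue_of pr_p.
  have dmapK (R1 R3 R4 : comNzRingType) (g1 : {rmorphism R1 -> R3}) (g2 : {rmorphism R3 -> R4}) (a : diffop R1) :
      dmap g2 (dmap g1 a) = dmap (g2 \o g1) a.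
    by apply/dcoefP => k l; rewrite !dcoef_dmap.
  have QP2 : dmap g Q' * dmap g P' - dmap g P' * dmap g Q' = 1.
    apply/eqP; rewrite -subr_eq0 -(rmorph1 (dmap g)) -!rmorphM -!rmorphB; apply/eqP.
    apply: (dmap_specializes sp); rewrite !rmorphB !rmorphM rmorph1 /= eP eQ QP.
    exact: subrr.
  have skQ2 : anti (dmap g Q') = - dmap g Q'.
    apply/eqP; rewrite -addr_eq0 anti_dmap -rmorphD; apply/eqP.
    apply: (dmap_specializes sp); rewrite rmorphD /= -anti_dmap eQ skQ.
    exact: addNr.
  have sq0 : (p ^ 2)%:R = 0 :> 'Z_(p ^ 2) by rewrite pchar_Zp // sqr_prime_gt1.
  have p_odd : odd p by case: (even_prime pr_p) => // p2; move: Bp; rewrite p2; lia.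
  apply: (skew_partner_reduction (pchar_Fp pr_p) sq0 (rho := rho) _ _ QP2 _ _ skQ2 p_odd).
  - exact: residue_ker.
  - exact: residue_torsion.
  - by rewrite dmapK; exact: (suppS _ _ true).
  - by rewrite dmapK; exact: (suppS _ _ false).
  - by apply: leq_ltn_trans Bp; rewrite leq_addr.
  rewrite !dcoef_dmap; have : rho (g (dcoef Q' i j)) \is a GRing.unit by apply: rmorph_unit.
  by rewrite unitfE.
have eQc : Q = dcoef Q 0 1 *: dD K.
  apply/dcoefP => i j; rewrite dcoefZ.
  have -> : dcoef (dD K) i j = ((i == 0%N) && (j == 1%N))%:R.
    by have := dcoef_monomial K 0 1 i j; rewrite expr0 mul1r expr1.
  have [e0|/bad[-> ->]] := eqVneq (dcoef Q i j) 0; last by rewrite mulr1.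
  case: andP => [[/eqP ei /eqP ej]|]; last by rewrite mulr0.
  by move: e0; rewrite ei ej => ->; rewrite mul0r.
exists (dcoef Q 0 1) => //; apply/eqP => c0; move: QP.
rewrite eQc c0 scale0r mul0r mulr0 subrr => /eqP.
by rewrite eq_sym oner_eq0.
Qed.

(** * Normally ordered operators as a model of the Weyl algebra *)

Section WeylAlgebra.
Variable K : fieldType.
Hypothesis charK : [pchar K] =i pred0.
Local Notation A := (weyl K).
Local Notation x := (weyl_x K).
Local Notation y := (weyl_y K).

Let K2 : 2%:R != 0 :> K.
Proof. by move/pcharf0P: charK => ->. Qed.

Definition weyl_X : A := x + y.
Definition weyl_D : A := 2%:R^-1 *: (y - x).

Lemma weyl_DX : weyl_D * weyl_X - weyl_X * weyl_D = 1.
Proof.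
rewrite -scalerAl -scalerAr -scalerBr.
have -> : (y - x) * (x + y) - (x + y) * (y - x) = 2%:R *: (y * x - x * y).
  rewrite scaler_nat mulrBl mulrBr !mulrDr !mulrDl !opprD !opprK.
  rewrite [LHS](AC ((2*2)*(2*2)) (((1*4)*(8*5))*((2*6)*(7*3)))) /=.
  by rewrite !subrr !addr0.
by rewrite weyl_rel scalerA mulVf // scale1r.
Qed.

Lemma weyl_exchange1 : weyl_exchange (1 : A) = 1.
Proof. by rewrite -[1]/(weyl_one K) weyl_exchange_pi free_exchange1. Qed.

Lemma weyl_exchange_X : weyl_exchange weyl_X = weyl_X.
Proof. by rewrite linearD /= weyl_exchange_x weyl_exchange_y addrC. Qed.

Lemma weyl_exchange_D : weyl_exchange weyl_D = - weyl_D.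
Proof.
by rewrite linearZ linearB /= weyl_exchange_x weyl_exchange_y -scalerN opprB.
Qed.

Lemma weyl_generated (I : A -> Prop) :
    I 0 -> I 1 -> (forall u v, I u -> I v -> I (u + v)) ->
    (forall u v, I u -> I v -> I (u * v)) -> (forall c u, I u -> I (c *: u)) ->
    I x -> I y ->
  forall u, I u.
Proof.
move=> I0 I1 ID IM IZ Ix Iy u; rewrite -(weyl_piK u) [repr u]monalgE.
have IW (w : {fmonom bool}) : I (weyl_pi << w >>).
  case: w; elim=> [|b w IHw].
    have -> : << FMonom [::] >> = 1 :> free2 K.
      by rewrite -mpolyC1E; congr (<< _ >>); apply/val_inj; rewrite /= fm1.
    exact: I1.
  have -> : << FMonom (b :: w) >> = << fmu b >> * << FMonom w >> :> free2 K.
    by rewrite free_mulUU mulr1; congr (<< _ >>); apply/val_inj; rewrite /= fmM fmU.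
  by rewrite weyl_piM; apply: IM => //; case: b.
elim/big_ind: _ => [|p q|w _].
- by rewrite weyl_piE raddf0.
- by rewrite weyl_piD; apply: ID.
have -> : << (repr u)@_w *g w >> = (repr u)@_w *: << w >> :> free2 K.
  by rewrite -mul_malgC free_mulUU mulr1 mul1m.
by rewrite weyl_piZ; apply: IZ.
Qed.

Lemma horner_alg_deriv (s : {poly K}) :
  weyl_D * horner_alg weyl_X s = horner_alg weyl_X s * weyl_D + horner_alg weyl_X s^`().
Proof.
elim/poly_ind: s => [|s c IH]; first by rewrite deriv0 !rmorph0 mulr0 mul0r addr0.
have eDX : weyl_D * weyl_X = weyl_X * weyl_D + 1 by rewrite -weyl_DX addrC subrK.
rewrite derivMXaddC !rmorphD !rmorphM /= horner_algX horner_algC.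
have cD : weyl_D * c%:A = c%:A * weyl_D by rewrite -scalerAr mulr1 -scalerAl mul1r.
rewrite mulrDr cD mulrA IH !mulrDl -!mulrA eDX mulrDr mulr1.
by rewrite [RHS]addrAC !addrA.
Qed.

(** An isomorphism, by [to_weyl_inj] and [to_weyl_surj], that carries the formal adjoint to the
    exchange involution. *)
Definition to_weyl : diffop K -> A := dint_with horner_alg_deriv.

HB.instance Definition _ := GRing.RMorphism.on to_weyl.

Lemma to_weyl_dX : to_weyl (dX K) = weyl_X.
Proof. by rewrite /to_weyl dint_dC /= horner_algX. Qed.

Lemma to_weyl_dD : to_weyl (dD K) = weyl_D.
Proof. exact: dint_dD. Qed.

Lemma to_weylZ c a : to_weyl (c *: a) = c *: to_weyl a.
Proof.
by rewrite dscaleE /to_weyl dint_dC_mul /= horner_algC -scalerAl mul1r.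
Qed.

(** Without torsion any degree bound serves in [dint_inj], and nonzero scalars are units, hence not
    killed. *)
Lemma pchar0_dint_inj (B : nzRingType) (iota : {rmorphism {poly K} -> B}) (D : B)
    (H : forall s, D * iota s = iota s * D + iota s^`()) :
  forall a, dint_with H a = 0 -> a = 0.
Proof.
move=> a; have [c ac] := bipoly_bound (fun _ : unit => (a : {poly {poly K}})).
apply: (@dint_inj _ _ _ _ _ c.+1).
- move=> k r /andP[k0 _] /eqP; rewrite -mulr_natr mulf_eq0 => /orP[/eqP//|].
  by move/pcharf0P: charK => ->; rewrite eqn0Ngt k0.
- move=> r r0; apply/eqP; apply: contraT => rn0.
  have : iota (r%:P * (r^-1)%:P) = 0 by rewrite rmorphM /= r0 mul0r.
  by rewrite -polyCM divff // rmorph1 => /eqP; rewrite oner_eq0.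
- apply/leqW/leq_sizeP => j cj; apply/polyP => i; rewrite coef0.
  by rewrite (ac tt) ?cj ?orbT.
- by move=> j; apply/leqW/leq_sizeP => i ci; rewrite (ac tt) ?ci.
Qed.

Lemma to_weyl_inj a : to_weyl a = 0 -> a = 0.
Proof. exact: pchar0_dint_inj. Qed.

Lemma weyl_x_XD : x = 2%:R^-1 *: weyl_X - weyl_D.
Proof.
by rewrite -scalerBr opprB addrC addrAC addrA addrK -mulr2n -scaler_nat scalerA mulVf // scale1r.
Qed.

Lemma weyl_y_XD : y = 2%:R^-1 *: weyl_X + weyl_D.
Proof.
by rewrite -scalerDr addrC addrA subrK -mulr2n -scaler_nat scalerA mulVf // scale1r.
Qed.

Lemma to_weyl_surj u : exists a, to_weyl a = u.
Proof.
have Z c a : to_weyl (c *: a) = c *: to_weyl a := to_weylZ c a.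
elim/weyl_generated: u => [||_ _ [a <-] [b <-]|_ _ [a <-] [b <-]|c _ [a <-]||].
- by exists 0; rewrite rmorph0.
- by exists 1; rewrite rmorph1.
- by exists (a + b); rewrite rmorphD.
- by exists (a * b); rewrite rmorphM.
- by exists (c *: a); rewrite Z.
- by exists (2%:R^-1 *: dX K - dD K); rewrite rmorphB /= Z to_weyl_dX to_weyl_dD -weyl_x_XD.
- by exists (2%:R^-1 *: dX K + dD K); rewrite rmorphD /= Z to_weyl_dX to_weyl_dD -weyl_y_XD.
Qed.

Lemma to_weyl_anti a : to_weyl (anti a) = weyl_exchange (to_weyl a).
Proof.
elim/diffop_ind: a => [|a s IH]; first by rewrite !raddf0.
rewrite raddfD /= anti_mul_dD anti_dC rmorphD rmorphM rmorphN /= to_weyl_dD IH.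
rewrite [to_weyl (a * _ + _)]rmorphD rmorphM /= linearD /= weyl_exchangeM to_weyl_dD weyl_exchange_D.
congr (_ + _); rewrite /to_weyl dint_dC.
elim/poly_ind: s => [|s c IHs]; first by rewrite !raddf0.
rewrite rmorphD rmorphM /= horner_algX horner_algC linearD /= weyl_exchangeM linearZ /= weyl_exchange_X.
rewrite -IHs weyl_exchange1; congr (_ + _).
by have := congr1 (horner_alg weyl_X) (mulrC s 'X); rewrite !rmorphM /= horner_algX.
Qed.

End WeylAlgebra.

(** * Bijectivity of compatible endomorphisms *)

Theorem theorem2p9 (K : fieldType) (charK : [pchar K] =i pred0)
    (f : {lrmorphism weyl K -> weyl K}) (falpha : exchange_endomorphism f) :
  exchange_automorphism f.
Proof.
split=> //.
have natK : forall n, (n%:R == 0 :> K) = (n == 0%N) by apply/pcharf0P.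
have [P eP] := to_weyl_surj charK (f (weyl_X K)).
have [Q eQ] := to_weyl_surj charK (f (weyl_D K)).
have QP : Q * P - P * Q = 1.
  apply/eqP; rewrite -subr_eq0; apply/eqP/(to_weyl_inj (charK := charK)).
  rewrite !rmorphB !rmorphM rmorph1 /= eP eQ -!rmorphM -!rmorphB.
  by rewrite weyl_DX // rmorph1 subrr.
have skQ : anti Q = - Q.
  apply/eqP; rewrite -addr_eq0; apply/eqP/(to_weyl_inj (charK := charK)).
  rewrite rmorphD /= to_weyl_anti eQ -falpha weyl_exchange_D rmorphN; exact: addNr.
have [c cn0 eQc] := skew_partner charK QP skQ.
have fD : f (weyl_D K) = c *: weyl_D K by rewrite -eQ eQc to_weylZ to_weyl_dD.
have fDinv : f (c^-1 *: weyl_D K) = weyl_D K.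
  by rewrite linearZ /= fD scalerA mulVf // scale1r.
pose H : diffop K := P - c^-1 *: dX K.
have HD : H * dD K = dD K * H.
  have DP : c *: (dD K * P - P * dD K) = 1 by rewrite scalerBr scalerAl scalerAr -eQc.
  have {}DP : dD K * P - P * dD K = c^-1 *: 1 by rewrite -DP scalerA mulVf // scale1r.
  apply/esym/eqP; rewrite -subr_eq0 mulrBr mulrBl -scalerAl -scalerAr opprB.
  rewrite (AC (2*2) ((1*4)*(3*2))) /= DP -scalerBr -scalerDr.
  by rewrite -(weyl_relation K) addrA subrK subrr scaler0.
(* [H] commutes with D, so in characteristic 0 it is a polynomial in D, and D is the image of
   [c^-1 D]. *)
have [u eu] : exists u, f u = to_weyl charK H.
  exists (\sum_(j < size (H : {poly {poly K}})) dcoef H 0 j *: (c^-1 *: weyl_D K) ^+ j).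
  rewrite linear_sum; apply: eq_bigr => j _ /=.
  have -> : (H : {poly {poly K}})`_j = (dcoef H 0 j)%:P.
    apply/polyP => -[|i]; rewrite coefC //=; have /eqP := commute_dD HD i j.
    by rewrite -mulr_natr mulf_eq0 natK orbF => /eqP.
  by rewrite linearZ /= rmorphXn /= fDinv horner_algC -scalerAl mul1r.
have fX : f (c *: (weyl_X K - u)) = weyl_X K.
  rewrite linearZ /= linearB /= eu rmorphB /= to_weylZ to_weyl_dX eP opprB addrCA subrr addr0.
  by rewrite scalerA divff // scale1r.
have surj w : exists v, f v = w.
  elim/weyl_generated: w => [||_ _ [v <-] [w <-]|_ _ [v <-] [w <-]|r _ [v <-]||].
  - by exists 0; rewrite rmorph0.
  - by exists 1; rewrite rmorph1.
  - by exists (v + w); rewrite rmorphD.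
  - by exists (v * w); rewrite rmorphM.
  - by exists (r *: v); rewrite linearZ.
  - exists (2%:R^-1 *: (c *: (weyl_X K - u)) - c^-1 *: weyl_D K).
    by rewrite linearB /= linearZ /= fX fDinv -weyl_x_XD.
  - exists (2%:R^-1 *: (c *: (weyl_X K - u)) + c^-1 *: weyl_D K).
    by rewrite linearD /= linearZ /= fX fDinv -weyl_y_XD.
have inj : injective f.
  move=> v w /eqP; rewrite -subr_eq0 -rmorphB => /eqP.
  have [a ea] := to_weyl_surj charK (v - w); rewrite -ea => fa0.
  apply/eqP; rewrite -subr_eq0 -ea; apply/eqP.
  (* The composite of [f] with [to_weyl] is again an interpretation of operators, with D sent to
     [f D], so it has trivial kernel. *)
  pose iota : {rmorphism {poly K} -> weyl K} := f \o horner_alg (weyl_X K).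
  have Hi s : f (weyl_D K) * iota s = iota s * f (weyl_D K) + iota s^`().
    by rewrite /iota /= -!rmorphM -rmorphD horner_alg_deriv.
  suff -> : a = 0 by exact: rmorph0.
  apply: (pchar0_dint_inj charK (H := Hi)); rewrite -[RHS]fa0 /to_weyl /dint_with rmorph_sum.
  by apply: eq_bigr => j _; rewrite rmorphM rmorphXn.
have [g gK] := choice surj.
by exists g => // v; apply: inj; rewrite gK.
Qed.
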